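(* Let $q\ge 3$ be a prime number. Let $m,n\in\mathbb{Z}$ and assume that $$p:=\sum_{i=0}^{q-1}m^i n^{q-1-i}=\Phi_q(n/m)\,m^{q-1}$$ is a prime number other than $q$. Then the following are equivalent. (1) $\left(\frac{q}{p}\right)_q=1$. (2) $f_q\left(\frac{-n}{m-n}\right)\in q^2\mathbb{Z}_{(q)}$. (3) $\frac{-n}{m-n}\bmod q^2\in S_q$.
   Context: $\Phi_q(x)=\sum_{i=0}^{q-1}x^i$. $\mathbb{Z}_{(q)}$ denotes the localization of $\mathbb{Z}$ at the prime ideal $q\mathbb{Z}$; elements of $\mathbb{Z}_{(q)}$ are reduced modulo $q^2$ via $\mathbb{Z}_{(q)}/q^2\mathbb{Z}_{(q)}\cong\mathbb{Z}/q^2\mathbb{Z}$. For a prime $p\equiv 1 \bmod q$ and $a\in\mathbb{Z}$, the rational $q$-th power residue symbol is defined by $\left(\frac{a}{p}\right)_q=1$ if there exists $b\in\mathbb{Z}$ with $a\equiv b^q \bmod p$, and $\left(\frac{a}{p}\right)_q=-1$ otherwise. The polynomial $f_q$ and the set $S_q$ are defined by $$f_q(x):=\sum_{t=1}^{q}\left(\sum_{\substack{1\le j,k,l\le q-1\\ k\equiv jl \bmod q}}(-1)^k\binom{t}{k}jl\right)\frac{x^t}{t}\in\mathbb{Z}_{(q)}[x],$$ $$S_q:=\{a-f_q(a)\bmod q^2\in\mathbb{Z}/q^2\mathbb{Z}\mid a=0,1,\dots,q-1\},$$ where $\binom{t}{k}=0$ for $k>t$. The assumption that $p$ is a prime other than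 $q$ implies $m-n\not\equiv 0\bmod q$ and $p\equiv 1\bmod q$, so that $\frac{-n}{m-n}\in\mathbb{Z}_{(q)}$ and the symbol is defined. *)

(* Defs.v *)
From HB Require Import structures.
From mathcomp Require Import all_boot all_order all_algebra.
From mathcomp Require Import boolp.

Set Implicit Arguments.
Unset Strict Implicit.
Unset Printing Implicit Defensive.

Import Order.TTheory GRing.Theory Num.Theory.
Local Open Scope ring_scope.

(* [Zloc q x] says that the rational x lies in the localization Z_(q); Z_(q)
   is represented throughout as a subset of [rat]. *)
Definition Zloc (q : nat) (x : rat) : Prop :=
  exists a s : int, ~~ (q %| s)%Z /\ x = a%:~R / s%:~R.

Definition q2Zloc (q : nat) (x : rat) : Prop :=
  exists2 y : rat, Zloc q y & x = (q ^ 2)%:R * y.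

(* The isomorphism Z_(q) / q^2 Z_(q) = Z / q^2 Z, for q prime. It is total on
   [rat], but only meaningful on Z_(q), where it sends any fraction a / s with
   s prime to q to a * s^-1: see [redq2_frac] below. *)
Definition redq2 (q : nat) (x : rat) : 'Z_(q ^ 2) :=
  (numq x)%:~R / (denq x)%:~R.

Definition power_residue_symbol (q : nat) (a : int) (p : nat) : int :=
  if `[< exists b : int, (a = b ^+ q %[mod p])%Z >] then 1 else -1.

Definition fq_sum (q t : nat) : int :=
  \sum_(1 <= j < q) \sum_(1 <= k < q)
    \sum_(1 <= l < q | k == j * l %[mod q])
      (-1) ^+ k * ('C(t, k) * j * l)%N%:Z.

Definition fq (q : nat) : {poly rat} :=
  \sum_(1 <= t < q.+1) ((fq_sum q t)%:~R / t%:R) *: 'X^t.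

Definition Sq (q : nat) : {set 'Z_(q ^ 2)} :=
  [set redq2 q (a%:R - (fq q).[a%:R]) | a : 'I_q].

Lemma redq2_frac (q : nat) (a s : int) :
  prime q -> ~~ (q %| s)%Z ->
  redq2 q (a%:~R / s%:~R) = a%:~R / s%:~R.
Proof.
move=> pq qs; rewrite /redq2; set x := _ / _ : rat.
have q2 : (1 < q ^ 2)%N by rewrite (ltn_exp2l 0 2) // prime_gt1.
have s0 : s != 0 by apply: contraNneq qs => ->; rewrite dvdz0.
have unitz (d : int) : ~~ (q %| d)%Z -> (d%:~R : 'Z_(q ^ 2)) \is a GRing.unit.
  rewrite /dvdz /= => qd.
  have -> : (d%:~R : 'Z_(q ^ 2)) = (-1) ^+ (d < 0)%R * `|d|%N%:R.
    by rewrite {1}[d]intEsign rmorphM rmorph_sign /= pmulrn.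
  by rewrite unitrMl ?unitrX ?unitrN1 // unitZpE // coprimeXl // prime_coprime.
have sx : a * denq x = numq x * s.
  apply: (@intr_inj rat); rewrite !rmorphM /=.
  have /eqP := divq_num_den x.
  rewrite /x eqr_div ?intr_eq0 ?denq_neq0 // => /eqP.
  by move=> <-; rewrite mulrC.
have qd : ~~ (q %| denq x)%Z.
  apply: contra qs => qd.
  have : (q %| numq x * s)%Z by rewrite -sx dvdz_mull.
  rewrite Gauss_dvdzr // /coprimez /gcdz /=.
  rewrite -[_ == 1]/(coprime q `|numq x|) prime_coprime //.
  apply/negP => qn; have := coprime_num_den x.
  rewrite /coprime => /eqP g1.
  have : (q %| gcdn `|numq x| `|denq x|)%N by rewrite dvdn_gcd qn.
  by rewrite g1 dvdn1 => /eqP q1; rewrite q1 in pq.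
apply: (mulIr (unitz _ qd)); rewrite divrK ?unitz //.
apply: (mulIr (unitz _ qs)).
by rewrite mulrAC divrK ?unitz // -!rmorphM /= -sx.
Qed.

Lemma fq_Zloc (q i : nat) : prime q -> Zloc q (fq q)`_i.
Proof.
move=> pq; have q0 := prime_gt0 pq.
have n1 : ~~ (q %| 1)%Z.
  by rewrite -[(_ %| _)%Z]/(q %| 1)%N dvdn1; case: eqP pq => // ->.
have -> : (fq q)`_i =
    if (0 < i <= q)%N then (fq_sum q i)%:~R / i%:R else 0.
  rewrite coef_sum; case: ifP => [/andP[i0 iq] | iF].
    rewrite (bigD1_seq i) ?mem_index_iota ?iota_uniq ?i0 //=.
    rewrite coefZ coefXn eqxx mulr1 big1 ?addr0 // => t ti.
    by rewrite coefZ coefXn eq_sym (negPf ti) mulr0.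
  rewrite big_seq_cond big1 // => t; rewrite andbT mem_index_iota ltnS => tq.
  rewrite coefZ coefXn; case: eqP => [it | _]; last by rewrite mulr0.
  by rewrite it tq in iF.
case: ifP => [/andP[i0 iq] | _]; last by exists 0, 1; rewrite mul0r.
have [iltq | qi] := ltnP i q.
  exists (fq_sum q i), i; split=> //.
  by rewrite -[(_ %| _)%Z]/(q %| i)%N gtnNdvd.
have -> : i = q by apply/eqP; rewrite eqn_leq iq.
have /dvdzP[c ->] : (q %| fq_sum q q)%Z.
  rewrite /fq_sum; rewrite big_seq; apply: rpred_sum => j _.
  rewrite big_seq; apply: rpred_sum => k; rewrite mem_index_iota => kq.
  apply: rpred_sum => l _; apply: dvdz_mull.
  rewrite -[(_ %| _)%Z]/(q %| 'C(q, k) * j * l)%N -mulnA dvdn_mulr //.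
  exact: prime_dvd_bin.
exists c, 1; split=> //.
by rewrite rmorphM /= divr1 mulfK // pnatr_eq0 -lt0n.
Qed.

(* Main.v *)
From HB Require Import structures.
Require Import Defs.
From mathcomp Require Import all_boot all_order all_algebra.
From mathcomp Require Import all_solvable all_field boolp.
From mathcomp Require Import ring zify.

Set Implicit Arguments.
Unset Strict Implicit.
Unset Printing Implicit Defensive.

Import Order.TTheory GRing.Theory Num.Theory.
Local Open Scope ring_scope.

(** Let zeta be a primitive q-th root of unity and lambda = 1 - zeta.  The
    prime p is the norm of m - n zeta, so p = 1 mod q and z = m / n has order q
    modulo p.  Normalise by z a character chi of order q of F_p: its value at t
    is zeta^(dlog t), where t^((p - 1) / q) = z^(- dlog t).  Then q is a q-th
    power modulo p exactly when q divides nu = dlog q.  The number nu is read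
    off from the Gauss sum G of chi, computed in two ways.

    First, raising to the q-th power acts on the p-th roots of unity in G as
    multiplication of the exponents by q, which chi detects:
      (- G)^q = 1 + nu lambda^q modulo lambda^(q + 1)  ([gauss_congr]).
    Secondly, by the easy case of Stickelberger's theorem, where all primes
    have degree one and are principal,
      G^q = +- zeta^k prod_(0 < l < q) (m - n zeta^(1 / l))^l
    ([stickelberger]).  Indeed G^q is p times a product of Jacobi sums; the
    divisors of a Jacobi sum are seen by reducing it modulo the primes above p
    ([jacobi_poly_root], [dvd_pis]); the two sides have
    the same absolute value, and an element of Z[zeta] of absolute value one is
    +- zeta^k ([ev_root_unity]).

    With a = - n / (m - n) modulo q^2 the two computations give
      c zeta^k prod_l (1 + a (zeta^(1 / l) - 1))^l
        = 1 + nu lambda^q modulo lambda^(q + 1)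
    for some integer c.  Kummer's logarithmic derivative extracts nu: with
    D = X d/dX, the value of D^q log F at X = 1 is additive in F, is 0 on
    constants and on powers of X, and is q nu modulo q^2 as soon as
    F(zeta) = 1 + nu lambda^q modulo lambda^(q + 1)  ([unit_expand],
    [logder_unit]).  For F = 1 + a (X - 1) call this value kummer(a).  It is a
    multiple of q, and for the product above the value is
    sum_l l l^(- q) kummer(a) = - kummer(a) modulo q^2.  Hence q | nu if and
    only if q^2 | kummer(a)  ([residue_criterion]).

    The two other conditions are restatements: f_q(a) = kummer(a) modulo q^2
    for all integers a ([fq_kummer]), and
    kummer(b + q d) = kummer(b) + q d modulo q^2 ([kummer_shift]), so that each
    residue class b modulo q contains exactly one zero of kummer modulo q^2,
    namely b - kummer(b). *)


(** * The operator X d/dX on integer polynomials *)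

Lemma poly_divX (h : {poly int}) (c : int) :
  exists h', h = h.[c]%:P + ('X - c%:P) * h'.
Proof.
have rc : root (h - h.[c]%:P) c by rewrite rootE !hornerE subrr.
by have [h' E] := factor_theorem _ _ rc; exists h'; rewrite mulrC -E subrKC.
Qed.

(** With X = exp v this is d/dv, so [moment n] below is the n-th derivative at v = 0. *)
Definition eulerD (h : {poly int}) : {poly int} := 'X * h^`().

Definition moment (n : nat) (h : {poly int}) : int := (iter n eulerD h).[1].

Lemma eulerDM F G : eulerD (F * G) = eulerD F * G + F * eulerD G.
Proof. rewrite /eulerD derivM; ring. Qed.

Lemma eulerDD F G : eulerD (F + G) = eulerD F + eulerD G.
Proof. by rewrite /eulerD derivD mulrDr. Qed.

Lemma eulerDZ c F : eulerD (c *: F) = c *: eulerD F.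
Proof. by rewrite /eulerD derivZ scalerAr. Qed.

Lemma eulerDXn k : eulerD 'X^k = k%:R *: 'X^k.
Proof.
case: k => [|k]; rewrite /eulerD derivXn ?mulr0n ?mulr0 ?scale0r //=.
by rewrite mulrnAr -exprS scaler_nat.
Qed.

Lemma eulerD_Xj j h : eulerD (h \Po 'X^j) = j%:R *: (eulerD h \Po 'X^j).
Proof.
rewrite {1}/eulerD deriv_comp mulrCA -/(eulerD 'X^j) eulerDXn /eulerD.
by rewrite comp_polyM comp_polyX -scalerAr mulrC.
Qed.

Lemma moment_is_linear n : linear (moment n : {poly int} -> int^o).
Proof.
move=> c F G; rewrite /moment.
have -> : iter n eulerD (c *: F + G) = c *: iter n eulerD F + iter n eulerD G.
  by elim: n => //= n ->; rewrite eulerDD eulerDZ.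
by rewrite !hornerE.
Qed.
HB.instance Definition _ n :=
  GRing.isLinear.Build int {poly int} int^o _ (moment n) (moment_is_linear n).

Lemma momentZ n c h : moment n (c *: h) = c * moment n h.
Proof. by rewrite linearZ. Qed.

Lemma momentS n h : moment n.+1 h = moment n (eulerD h).
Proof. by rewrite /moment iterSr. Qed.

Lemma momentXn n k : moment n 'X^k = k%:R ^+ n.
Proof.
elim: n => [|n IH]; first by rewrite /moment /= hornerXn expr1n.
by rewrite momentS eulerDXn momentZ IH exprS.
Qed.

Lemma moment_coef n h : moment n h = \sum_(i < size h) h`_i * i%:R ^+ n.
Proof.
rewrite -{1}[h]coefK poly_def linear_sum /=; apply: eq_bigr => i _.
by rewrite momentZ momentXn.
Qed.

(** The operator lowers the order of vanishing at X = 1 by exactly one. *)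
Lemma moment_X1_pow n h : moment n (('X - 1) ^+ n * h) = n`!%:R * h.[1].
Proof.
elim: n h => [|n IH] h; first by rewrite /moment /= expr0 !mul1r.
rewrite momentS.
have -> : eulerD (('X - 1) ^+ n.+1 * h) =
    ('X - 1) ^+ n * (n.+1%:R *: ('X * h) + ('X - 1) * ('X * h^`())).
  rewrite /eulerD derivM deriv_exp derivB derivX -polyC1 derivC /= scaler_nat -mulr_natr.
  rewrite [('X - 1%:P) ^+ n.+1]exprS; ring.
by rewrite IH !hornerE /= factS; ring.
Qed.

Lemma moment_X1_pow0 k n h : (k < n)%N -> moment k (('X - 1) ^+ n * h) = 0.
Proof.
move=> kn; rewrite -(subnKC kn) exprD exprSr -!mulrA moment_X1_pow.
by rewrite !hornerM !hornerE /= subrr !(mul0r, mulr0).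
Qed.

Lemma moment_Xj n j h : moment n (h \Po 'X^j) = j%:R ^+ n * moment n h.
Proof.
elim: n h => [|n IH] h; first by rewrite /moment /= horner_comp hornerXn expr1n mul1r.
by rewrite momentS eulerD_Xj momentZ IH exprS -momentS mulrA.
Qed.

(** * Power sums modulo the square of q *)

Section OddPrime.

Variable q : nat.
Hypothesis q_prime : prime q.
Hypothesis q_gt2 : (2 < q)%N.

(** The cofactor of x - y in x^q - y^q is a sum of q terms that are all
    congruent modulo q. *)
Lemma dvdz_expq_sub (x y : int) :
  (q %| x - y)%Z -> (q%:Z ^+ 2 %| x ^+ q - y ^+ q)%Z.
Proof.
move=> xy; rewrite subrXX -[q%:Z ^+ 2]/(q%:Z * q%:Z) dvdz_mul //.
have -> : \sum_(i < q) x ^+ (q.-1 - i) * y ^+ i =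
    \sum_(i < q) (x ^+ (q.-1 - i) * (y ^+ i - x ^+ i)) + q%:Z * x ^+ q.-1.
  have -> : q%:Z * x ^+ q.-1 = \sum_(i < q) x ^+ (q.-1 - i) * x ^+ i.
    rewrite (eq_bigr (fun=> x ^+ q.-1)); first by rewrite sumr_const card_ord -mulr_natl natz.
    by move=> i _; rewrite -exprD subnK // -ltnS prednK ?prime_gt0.
  by rewrite -big_split /=; apply: eq_bigr => i _; rewrite mulrBr subrK.
rewrite rpredD ?dvdz_mulr ?dvdzz //; apply: rpred_sum => i _.
by rewrite dvdz_mull // subrXX dvdz_mulr // -opprB rpredN.
Qed.

Lemma dvdz_fermat (x : int) : (q %| x ^+ q - x)%Z.
Proof.
rewrite (dvdz_pcharf (pchar_Fp q_prime)) rmorphB rmorphXn /= subr_eq0.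
by have := expf_card (x%:~R : 'F_q); rewrite card_Fp // => ->.
Qed.

Lemma odd_q : odd q.
Proof. by case: (even_prime q_prime) q_gt2 => [->|]. Qed.

Lemma sign_q (R : pzRingType) : (-1) ^+ q = -1 :> R.
Proof. by rewrite -signr_odd odd_q expr1. Qed.

Lemma sign_predq (R : pzRingType) : (-1) ^+ q.-1 = 1 :> R.
Proof.
have := oddS q.-1; rewrite prednK ?prime_gt0 // odd_q -signr_odd.
by move/esym/negbTE => ->.
Qed.

Lemma expq_odd (x : int) : (- x) ^+ q = - x ^+ q.
Proof. by rewrite exprNn sign_q mulN1r. Qed.

(** Modulo q^2 the q-th power of an integer depends only on its class modulo q
    (it is the Teichmueller lift), so the sum runs over all classes; the
    involution i -> - i changes its sign. *)
Lemma sum_expq_shift (s : nat) :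
  (q%:Z ^+ 2 %| \sum_(i < q) (i + s)%:R ^+ q)%Z.
Proof.
have q0 := prime_gt0 q_prime.
have step s' : (q%:Z ^+ 2 %| \sum_(i < q) (i + s'.+1)%:R ^+ q -
    \sum_(i < q) (i + s')%:R ^+ q)%Z.
  have E : \sum_(i < q.+1) (i + s')%:R ^+ q = \sum_(i < q) (i + s'.+1)%:R ^+ q
      + s'%:R ^+ q :> int.
    rewrite big_ord_recl addrC add0n; congr (_ + _); apply: eq_bigr => i _.
    by rewrite /= /bump /= add1n addnS addSn.
  have -> : \sum_(i < q) (i + s'.+1)%:R ^+ q - \sum_(i < q) (i + s')%:R ^+ q
     = (q + s')%:R ^+ q - s'%:R ^+ q :> int.
    have := E; rewrite big_ord_recr /= => E'.
    by apply/eqP; rewrite subr_eq addrAC eq_sym subr_eq addrC E'.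
  by apply: dvdz_expq_sub; rewrite natrD addrK natz.
elim: s => [|s IH]; last by rewrite -[\sum__ _](subrK (\sum_(i < q) (i + s)%:R ^+ q)) rpredD.
have two : (q%:Z ^+ 2 %| 2%:R * \sum_(i < q) (i + 0)%:R ^+ q)%Z.
  rewrite mulr_natl mulr2n {1}(reindex_inj rev_ord_inj) /=.
  rewrite -[X in _ + X](subrK (\sum_(i < q) (i + 1)%:R ^+ q)) addrCA rpredD //.
    by rewrite -rpredN opprB step.
  rewrite -big_split /=; apply: rpred_sum => i _.
  have -> : (q - i.+1 + 0)%:R ^+ q + (i + 1)%:R ^+ q =
      (q - i.+1)%:R ^+ q - (- (i.+1)%:R) ^+ q :> int.
    by rewrite expq_odd opprK addn0 addn1.
  by apply: dvdz_expq_sub; rewrite opprK -natrD subnK // natz.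
by move: two; rewrite Gauss_dvdzr // coprimezXl // /coprimez /= -[_ == _]/(coprime q 2)
  prime_coprime // gtnNdvd.
Qed.

Definition cyclo : {poly int} := \sum_(i < q) 'X^i.

(** A case of [sum_expq_shift].  Thus [moment q] modulo q^2 is well defined on Z[zeta]: it is the functional
    that sends zeta^k to the Teichmueller lift of k. *)
Lemma moment_cyclo W : (q%:Z ^+ 2 %| moment q (cyclo * W))%Z.
Proof.
rewrite -[W]coefK poly_def mulr_sumr linear_sum /=; apply: rpred_sum => s _.
rewrite -scalerAr momentZ dvdz_mull // mulr_suml linear_sum /=.
rewrite (eq_bigr (fun i : 'I_q => (i + s)%:R ^+ q)) ?sum_expq_shift // => i _.
by rewrite -exprD momentXn.
Qed.

Lemma moment_q_deriv h : (q %| moment q h - h^`().[1])%Z.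
Proof.
have -> : h^`().[1] = moment 1 h by rewrite /moment /= /eulerD !hornerE.
rewrite !moment_coef -sumrB; apply: rpred_sum => i _.
by rewrite -mulrBr expr1 dvdz_mull ?dvdz_fermat.
Qed.

Lemma cyclo1 : cyclo.[1] = q%:Z.
Proof.
rewrite horner_sum (eq_bigr (fun=> 1)) => [|i _]; last by rewrite !hornerE expr1n.
by rewrite sumr_const card_ord natz.
Qed.

Lemma X1_cyclo : ('X - 1) * cyclo = 'X^q - 1.
Proof. by rewrite /cyclo subrX1. Qed.

(** Over F_q the cyclotomic polynomial is (X - 1)^(q - 1); in Z[zeta] this
    identity compares q with lambda^(q - 1). *)
Lemma X1_pow_cyclo : exists2 e : {poly int},
  ('X - 1) ^+ q.-1 = cyclo + q%:Z *: e & e.[1] = -1.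
Proof.
have q0 := prime_gt0 q_prime.
have y0 : ('X - 1 : {poly int}) != 0 by rewrite -polyC1 polyXsubC_eq0.
pose S : {poly int} := \sum_(1 <= i < q) (-1) ^+ i * 'X^(q - i) *+ ('C(q, i) %/ q).
have E : ('X - 1) ^+ q = 'X^q - 1 + q%:Z *: S.
  rewrite exprBn -(big_mkord xpredT (fun i => (-1) ^+ i * 'X^(q - i) * 1 ^+ i *+ 'C(q, i))).
  rewrite big_nat_recr //= big_ltn //= subnn subn0 bin0 binn !expr1n !expr0 !mulr1n !mulr1.
  rewrite mul1r -[RHS]addrA -addrA; congr (_ + _).
  rewrite sign_q addrC; congr (_ + _).
  rewrite /S scaler_sumr; apply: eq_big_nat => i /andP[i0 iq].
  rewrite expr1n mulr1 -[q%:Z]natz scaler_nat -mulrnA divnK //.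
  by apply: prime_dvd_bin; rewrite ?i0.
have S1 : root S 1.
  have := congr1 (horner^~ 1) E.
  rewrite !hornerE /= expr1n subrr expr0n gtn_eqF //= add0r.
  by move/esym/eqP; rewrite mulf_eq0 -rootE => /orP[|//]; rewrite eqz_nat gtn_eqF.
have [e De] := factor_theorem _ _ S1.
have E1 : ('X - 1) ^+ q.-1 = cyclo + q%:Z *: e.
  apply: (mulfI y0); rewrite -exprS prednK // E De polyC1 [RHS]mulrDr X1_cyclo.
  by rewrite -scalerAr [e * _]mulrC.
exists e => //.
have q1 : (0 < q.-1)%N by lia.
have := congr1 (horner^~ 1) E1.
rewrite !hornerE /= cyclo1 subrr expr0n gtn_eqF //.
move/esym/eqP; rewrite -{1}[q%:Z]mulr1 -mulrDr mulf_eq0 => /orP[|].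
  by rewrite eqz_nat gtn_eqF.
by rewrite addrC addr_eq0 => /eqP.
Qed.

End OddPrime.

(** * Logarithmic derivatives at X = 1 *)

(** K is D F / F up to order n at X = 1; stated without division, so that it makes
    sense over the integers.  If F(1) is not 0, it determines K modulo
    (X - 1)^n, hence the moments of K of order less than n. *)
Definition logder (n : nat) (K F : {poly int}) : Prop :=
  exists R, eulerD F = K * F + ('X - 1) ^+ n * R.

Lemma logderM n K1 K2 F1 F2 :
  logder n K1 F1 -> logder n K2 F2 -> logder n (K1 + K2) (F1 * F2).
Proof.
move=> [R1 E1] [R2 E2]; exists (R1 * F2 + F1 * R2).
rewrite eulerDM E1 E2; ring.
Qed.

Lemma logderC n c : logder n 0 c%:P.
Proof. by exists 0; rewrite /eulerD derivC; ring. Qed.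

Lemma logderXn n k : logder n k%:R%:P 'X^k.
Proof. by exists 0; rewrite eulerDXn mulr0 addr0 mul_polyC. Qed.

Lemma logder_exp n K F k : logder n K F -> logder n (K *+ k) (F ^+ k).
Proof.
move=> KF; elim: k => [|k IH]; first by rewrite mulr0n expr0 -polyC1; exact: logderC.
by rewrite exprS mulrS; apply: logderM.
Qed.

(** The substitution X -> X^j multiplies X d/dX by j, and (X^j - 1)^n is a multiple
    of (X - 1)^n. *)
Lemma logder_Xj n K F j :
  logder n K F -> logder n (j%:R *: (K \Po 'X^j)) (F \Po 'X^j).
Proof.
move=> [R E]; exists (j%:R *: ((\sum_(i < j) 'X^i) ^+ n * (R \Po 'X^j))).
have Ey : ('X - 1) \Po 'X^j = ('X - 1) * \sum_(i < j) 'X^i :> {poly int}.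
  by rewrite -subrX1 comp_polyB comp_polyX -polyC1 comp_polyC.
rewrite eulerD_Xj E comp_polyD !comp_polyM rmorphXn /= Ey exprMn scalerDr.
by rewrite -!scalerAl -!scalerAr mulrA.
Qed.

Lemma eulerD1 : eulerD 1 = 0.
Proof. by rewrite /eulerD -polyC1 derivC mulr0. Qed.

Section OddPrime.

Variable q : nat.
Hypothesis q_prime : prime q.
Hypothesis q_gt2 : (2 < q)%N.
Local Notation Phi := (cyclo q).

(** The hypothesis on F says that F(zeta) = 1 + nu lambda^q modulo
    lambda^(q + 1), see [unit_expand].  Writing F = 1 + G, one has
    D log F = D (G - G^2 / 2) modulo (q^2, (X - 1)^q): the error K G^2 is
    negligible, as Phi^2 = (X - 1)^(2 q - 2) modulo q (X - 1)^(q - 1) and q^2,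
    while q | K(1).  For the same reason the moment of G^2 vanishes modulo
    q^2, and so does that of Phi W, which leaves q nu. *)
Lemma logder_unit (K F A W : {poly int}) (nu : int) :
  logder q K F ->
  F = 1 + q%:Z *: (nu *: ('X - 1) + ('X - 1) ^+ 2 * A) + Phi * W ->
  (q%:Z ^+ 2 %| moment q.-1 K - q%:Z * nu)%Z.
Proof.
move=> [R DF] EF.
have q0 := prime_gt0 q_prime.
have [e Ee e1] := X1_pow_cyclo q_prime q_gt2.
have EPhi : Phi = ('X - 1) ^+ q.-1 - q%:Z *: e by rewrite Ee addrK.
have mpow n h : moment n (('X - 1) ^+ n * h) = n`!%:R * h.[1] := moment_X1_pow n h.
have mpow0 k n h : (k < n)%N -> moment k (('X - 1) ^+ n * h) = 0 := @moment_X1_pow0 k n h.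
have dy : ('X - 1 : {poly int})^`() = 1 by rewrite derivB derivX -polyC1 derivC subr0.
have yy : ('X - 1 : {poly int}).[1] = 0 by rewrite !hornerE subrr.
move: ('X - 1) DF EF dy yy EPhi mpow mpow0 => y DF EF dy yy EPhi mpow mpow0.
pose b := nu%:P + y * A.
have [G EG] : {G | G = q%:Z *: (y * b) + Phi * W} by eexists.
have FG : F = 1 + G.
  rewrite EF EG /b -addrA; congr (1 + (_ *: _ + _)).
  by rewrite mulrDr mulrA -expr2 -mul_polyC mulrC.
have DG : eulerD G = K * (1 + G) + y ^+ q * R.
  by rewrite -FG -DF FG [RHS]eulerDD eulerD1 add0r.
have [Y EY] : {Y | Y = y ^+ q.-1} by eexists.
have [R1 ER1] : {R1 | R1 = 2%:R *: (y * b * W) - 2%:R *: (e * W ^+ 2)} by eexists.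
have [R3 ER3] : {R3 | R3 = (y * b) ^+ 2 - 2%:R *: (y * e * b * W) + (e * W) ^+ 2}
  by eexists.
have G2 : G ^+ 2 = (q%:Z ^+ 2) *: R3 + q%:Z *: (Y * R1) + Y ^+ 2 * W ^+ 2.
  have -> : G = q%:Z *: (y * b) + (Y - q%:Z *: e) * W by rewrite EG EPhi EY.
  rewrite ER1 ER3 -!mul_polyC; ring.
(* K (1 - G^2) = (1 - G) D G up to (X - 1)^q, doubled to avoid G^2 / 2. *)
have K2 : 2%:R *: K = 2%:R *: eulerD G - eulerD (G ^+ 2) + 2%:R *: (K * G ^+ 2)
    - y ^+ q * (2%:R *: (R * (1 - G))).
  rewrite expr2 eulerDM DG -!mul_polyC; ring.
have Fone : F.[1] = 1 + q%:Z * W.[1].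
  rewrite EF EPhi !hornerE /= e1 yy !expr0n /= [q.-1 == _]gtn_eqF; last by lia.
  rewrite !mulr0n.
  by ring.
have qK1 : (q %| K.[1])%Z.
  have [B EB] : {B | B = nu *: y + y ^+ 2 * A - e * W} by eexists.
  have FB : F = 1 + q%:Z *: B + y * (y * (y ^+ (q - 3) * W)).
    have Eq1 : y ^+ q.-1 = y * (y * y ^+ (q - 3)) by rewrite -!exprS; congr (_ ^+ _); lia.
    rewrite EF EPhi Eq1 EB -!mul_polyC; ring.
  have dF : F^`().[1] = q%:Z * B^`().[1].
    rewrite FB !derivD derivZ -polyC1 derivC ![(y * _)^`()]derivM dy.
    by rewrite !hornerE yy /=; ring.
  have := congr1 (horner^~ 1) DF.
  rewrite /eulerD !hornerD !hornerM horner_exp yy Fone dF hornerX.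
  rewrite expr0n (gtn_eqF q0) mul0r addr0 mul1r => E.
  have : (q %| K.[1] * (1 + q%:Z * W.[1]))%Z by rewrite -E dvdz_mulr.
  move=> qK; have -> : K.[1] = K.[1] * (1 + q%:Z * W.[1]) - q%:Z * (K.[1] * W.[1]) by ring.
  by rewrite rpredB // dvdz_mulr.
have Y2 : Y ^+ 2 = y ^+ q.+1 * y ^+ (q - 3).
  rewrite EY -exprM -exprD; congr (_ ^+ _); lia.
have Y2' : Y ^+ 2 = y ^+ q * y ^+ (q - 2).
  rewrite EY -exprM -exprD; congr (_ ^+ _); lia.
have m2 : (q%:Z ^+ 2 %| 2%:R * (moment q.-1 K - q%:Z * nu))%Z.
  rewrite mulrBr -momentZ K2 !linearD !linearN /= !momentZ.
  rewrite -!momentS prednK // mpow0 ?subr0; last by rewrite prednK.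
  have mG : (q%:Z ^+ 2 %| moment q G - q%:Z * nu)%Z.
    rewrite EG linearD /= momentZ addrAC -mulrBr rpredD ?moment_cyclo // dvdz_mul //.
    have -> : nu = (y * b)^`().[1].
      by rewrite derivM dy /b !hornerE /= yy; ring.
    exact: moment_q_deriv.
  have mG2 : (q%:Z ^+ 2 %| moment q (G ^+ 2))%Z.
    rewrite G2 Y2 -mulrA !linearD /= !momentZ mpow0 // addr0.
    apply: rpredD; first exact: dvdz_mulr.
    rewrite expr2 dvdz_mul //.
    have := moment_q_deriv q_prime (Y * R1).
    have EY2 : Y = y * (y * y ^+ (q - 3)) by rewrite EY -!exprS; congr (_ ^+ _); lia.
    have -> : (Y * R1)^`().[1] = 0.
      by rewrite EY2 !derivM dy !hornerE yy /=; ring.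
    by rewrite subr0.
  have mKG : (q%:Z ^+ 2 %| moment q.-1 (K * G ^+ 2))%Z.
    have -> : K * G ^+ 2 = (q%:Z ^+ 2) *: (K * R3) + q%:Z *: (Y * (K * R1)) +
       y ^+ q * (y ^+ (q - 2) * W ^+ 2 * K).
      rewrite G2 Y2' -!mul_polyC; ring.
    rewrite !linearD /= !momentZ (mpow0 _ q) ?prednK // addr0.
    apply: rpredD; first exact: dvdz_mulr.
    by rewrite expr2 dvdz_mul // EY mpow hornerM dvdz_mull // dvdz_mulr.
  rewrite (_ : _ - _ =  2%:R * (moment q G - q%:Z * nu) - moment q (G ^+ 2)
      + 2%:R * moment q.-1 (K * G ^+ 2)); last by ring.
  by rewrite rpredD ?rpredB // dvdz_mull.
move: m2; rewrite Gauss_dvdzr // coprimezXl // /coprimez /= -[_ == _]/(coprime q 2).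
by rewrite prime_coprime // gtnNdvd.
Qed.

End OddPrime.

(** * The logarithmic derivative of 1 + a (X - 1) *)

Section OddPrime.

Variable q : nat.
Hypothesis q_prime : prime q.
Hypothesis q_gt2 : (2 < q)%N.

Definition kummer_coef (s : nat) : int := moment q.-1 ('X * ('X - 1) ^+ s).

Definition kummer_poly (a : int) : {poly int} :=
  \sum_(s < q) ((-1) ^+ s * a ^+ s.+1) *: ('X * ('X - 1) ^+ s).

(** This is D^q log (1 + a (X - 1)) at X = 1 ([moment_kummer_poly] and
    [logder_kummer_poly]), written as a polynomial in a with integer
    coefficients. *)
Definition kummer (a : int) : int := \sum_(s < q) (-1) ^+ s * a ^+ s.+1 * kummer_coef s.

Lemma moment_kummer_poly a : moment q.-1 (kummer_poly a) = kummer a.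
Proof. by rewrite linear_sum /=; apply: eq_bigr => s _; rewrite momentZ. Qed.

(** The defining sum is the truncated geometric series of a X / (1 + a (X - 1)). *)
Lemma logder_kummer_poly a : logder q (kummer_poly a) (1 + a%:P * ('X - 1)).
Proof.
exists ((- a)%:P ^+ q * a%:P * 'X).
have -> : kummer_poly a = a%:P * 'X * \sum_(s < q) ((- a)%:P * ('X - 1)) ^+ s.
  rewrite mulr_sumr; apply: eq_bigr => s _.
  rewrite exprMn -mul_polyC -polyC_exp (exprNn a) exprS !polyCM; ring.
have -> : eulerD (1 + a%:P * ('X - 1)) = a%:P * 'X.
  rewrite eulerDD eulerD1 add0r mul_polyC eulerDZ /eulerD derivB derivX -polyC1 derivC subr0.
  by rewrite mulr1 mul_polyC.
have -> : 1 + a%:P * ('X - 1) = - ((- a)%:P * ('X - 1) - 1) by rewrite polyCN; ring.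
by rewrite mulrN -[_ * _ * (_ - 1)]mulrA [_ * (_ - 1)]mulrC -subrX1 exprMn; ring.
Qed.

(** X (X - 1)^s is, up to the factor s + 1, the derivative of (X - 1)^(s + 1). *)
Lemma kummer_coefE s : s.+1%:R * kummer_coef s = moment q (('X - 1) ^+ s.+1).
Proof.
rewrite -(prednK (prime_gt0 q_prime)) momentS /kummer_coef /= -momentZ; congr moment.
rewrite /eulerD deriv_exp derivB derivX -polyC1 derivC subr0 polyC1 mul1r /=.
by rewrite scaler_nat mulrnAr.
Qed.

(** Modulo q the q-th moment is the first derivative at 1, by Fermat. *)
Lemma kummer_coef_modq s : (q %| s.+1%:R * kummer_coef s - (s == 0%N)%:R)%Z.
Proof.
rewrite kummer_coefE.
have -> : (s == 0%N)%:R = (('X - 1) ^+ s.+1)^`().[1] :> int.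
  rewrite deriv_exp derivB derivX -polyC1 derivC subr0 polyC1 mul1r /=.
  rewrite hornerMn horner_exp !hornerE subrr.
  by case: s => [|s]; rewrite ?expr0 // exprS mul0r mul0rn.
exact: moment_q_deriv.
Qed.

Lemma kummer_coef0 : kummer_coef 0 = 1.
Proof. by rewrite /kummer_coef expr0 mulr1 -['X]expr1 momentXn expr1n. Qed.

Lemma kummer_coef_last : (q %| kummer_coef q.-1 + 1)%Z.
Proof.
rewrite /kummer_coef mulrC moment_X1_pow hornerX mulr1.
have := Wilson (prime_gt1 q_prime); rewrite q_prime => /esym.
by rewrite -addn1 natz.
Qed.

(** Modulo q only the terms s = 0 and s = q - 1 survive, and they give a - a^q. *)
Lemma dvdz_kummer a : (q %| kummer a)%Z.
Proof.
have q0 := prime_gt0 q_prime.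
have -> : kummer a = \sum_(1 <= s < q.-1) (-1) ^+ s * a ^+ s.+1 * kummer_coef s
    + (a ^+ q * (kummer_coef q.-1 + 1) - (a ^+ q - a)).
  rewrite /kummer -(big_mkord xpredT (fun s => (-1) ^+ s * a ^+ s.+1 * kummer_coef s)).
  rewrite -(prednK q0) big_nat_recr //= prednK // (sign_predq q_prime q_gt2).
  rewrite big_ltn ?kummer_coef0; last by lia.
  by rewrite expr0 expr1; ring.
rewrite rpredD //; last by rewrite rpredB // ?dvdz_fermat // dvdz_mull ?kummer_coef_last.
rewrite big_seq; apply: rpred_sum => s; rewrite mem_index_iota => /andP[s0 sq1].
rewrite dvdz_mull //.
have := kummer_coef_modq s; rewrite (gtn_eqF s0) subr0 Gauss_dvdzr //.
rewrite natz /coprimez /= -[_ == _]/(coprime q s.+1) prime_coprime // gtnNdvd //; lia.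
Qed.

Lemma exprD_mod_sqr (b e : int) n :
  (e ^+ 2 %| (b + e) ^+ n.+1 - (b ^+ n.+1 + n.+1%:R * b ^+ n * e))%Z.
Proof.
elim: n => [|n IH].
  have -> : (b + e) ^+ 1 - (b ^+ 1 + 1%:R * b ^+ 0 * e) = 0 by ring.
  exact: dvdz0.
have -> : (b + e) ^+ n.+2 - (b ^+ n.+2 + n.+2%:R * b ^+ n.+1 * e) =
   (b + e) * ((b + e) ^+ n.+1 - (b ^+ n.+1 + n.+1%:R * b ^+ n * e))
   + e ^+ 2 * (n.+1%:R * b ^+ n).
  rewrite (exprS (b + e) n.+1) (exprS b n.+1) (exprS b n) -[n.+2]addn1 natrD; ring.
by apply: rpredD; [exact: dvdz_mull | exact: dvdz_mulr].
Qed.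

(** By [kummer_coef_modq] the derivative of [kummer] is 1 modulo q as a
    polynomial; this is Taylor's formula to first order. *)
Lemma kummer_shift b d :
  (q%:Z ^+ 2 %| kummer (b + q%:Z * d) - (kummer b + q%:Z * d))%Z.
Proof.
have -> : kummer (b + q%:Z * d) - (kummer b + q%:Z * d) =
  \sum_(s < q) ((-1) ^+ s * kummer_coef s * ((b + q%:Z * d) ^+ s.+1
       - (b ^+ s.+1 + s.+1%:R * b ^+ s * (q%:Z * d)))) +
  \sum_(s < q) (q%:Z * (s.+1%:R * kummer_coef s - ((s : nat) == 0%N)%:R)
       * ((-1) ^+ s * b ^+ s * d)).
  have E : \sum_(s < q) ((s : nat) == 0%N)%:R * ((-1) ^+ s * b ^+ s * d) = d.
    rewrite -(big_mkord xpredT (fun s => ((s : nat) == 0%N)%:R * ((-1) ^+ s * b ^+ s * d))).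
    rewrite big_ltn ?prime_gt0 // big_nat big1 => [|s /andP[s0 _]].
      by rewrite !expr0 mulr1n; ring.
    by rewrite gtn_eqF // mul0r.
  rewrite /kummer opprD addrA.
  rewrite [X in _ = _ + X](eq_bigr (fun s : 'I_q =>
      q%:Z * (s.+1%:R * kummer_coef s * ((-1) ^+ s * b ^+ s * d))
      - q%:Z * (((s : nat) == 0%N)%:R * ((-1) ^+ s * b ^+ s * d)))) => [|s _]; last by ring.
  rewrite sumrB -[X in _ = _ + (_ - X)]mulr_sumr E addrA; congr (_ - _).
  by rewrite -sumrB -big_split /=; apply: eq_bigr => s _; ring.
rewrite rpredD //; apply: rpred_sum => s _.
  rewrite dvdz_mull //; apply: dvdz_trans (exprD_mod_sqr _ _ _).
  by rewrite exprMn dvdz_mulr.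
by rewrite dvdz_mulr // dvdz_mul ?kummer_coef_modq.
Qed.

End OddPrime.

(** * The polynomial f_q modulo the square of q *)

Section OddPrime.

Variable q : nat.
Hypothesis q_prime : prime q.
Hypothesis q_gt2 : (2 < q)%N.

Lemma inv_modq j : (0 < j < q)%N -> j * j ^ (q - 2) = 1 %[mod q].
Proof.
move=> /andP[j0 jq]; rewrite -expnS.
have -> : (q - 2).+1 = totient q by rewrite totient_prime //; lia.
by rewrite Euler_exp_totient // coprime_sym prime_coprime // gtnNdvd.
Qed.

(** The quotient k / j modulo q, with j inverted by Fermat. *)
Definition quotq (k j : nat) : nat := (k * j ^ (q - 2)) %% q.

Lemma quotqP k j l : (0 < k < q)%N -> (0 < j < q)%N -> (l < q)%N ->
  (k == j * l %[mod q]) = (l == quotq k j).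
Proof.
move=> kq jq lq; apply/eqP/eqP => [E | ->].
  rewrite /quotq -modnMml E modnMml mulnAC -modnMml inv_modq // modnMml mul1n.
  by rewrite modn_small.
by rewrite /quotq modnMmr mulnCA -modnMmr inv_modq // modnMmr muln1.
Qed.

Lemma quotq_bound k j : (0 < k < q)%N -> (0 < j < q)%N -> (0 < quotq k j < q)%N.
Proof.
move=> kq jq; have lq : (quotq k j < q)%N by rewrite ltn_mod prime_gt0.
rewrite lq andbT lt0n; apply/negP => /eqP l0.
have := quotqP kq jq (prime_gt0 q_prime); rewrite l0 eqxx muln0 => /eqP.
by case/andP: kq => k0 kq; rewrite mod0n modn_small // => k1; rewrite k1 in k0.
Qed.

Lemma sum_quotq (F : nat -> int) k j : (0 < k < q)%N -> (0 < j < q)%N ->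
  \sum_(1 <= l < q | k == j * l %[mod q]) F l = F (quotq k j).
Proof.
move=> kq jq; rewrite big_nat_cond.
rewrite (eq_bigl (fun l => (1 <= l < q)%N && (l == quotq k j))).
  by rewrite -big_nat_cond big_nat1_eq quotq_bound.
by move=> l; case: (boolP (1 <= l < q)%N) => //= /andP[_ lq]; rewrite quotqP.
Qed.

Definition pair_sum (k : nat) : int :=
  \sum_(1 <= j < q) \sum_(1 <= l < q | k == j * l %[mod q]) (j * l)%N%:Z.

(** Write j^q = j + q e(j).  Since (j l)^q = k^q modulo q^2 whenever j l = k
    modulo q, each product j l is k^q - q (e(j) l + e(l) j); summing over the
    q - 1 pairs leaves - k^q, plus q times a sum that is linear in k = j l. *)
Lemma pair_sum_linear : exists C : int, forall k, (0 < k < q)%N ->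
  (q%:Z ^+ 2 %| pair_sum k + k%:Z ^+ q - q%:Z * (k%:Z * C))%Z.
Proof.
have q0 := prime_gt0 q_prime.
pose e (j : nat) : int := ((j%:Z ^+ q - j%:Z) %/ q)%Z.
have ee j : j%:Z ^+ q = j%:Z + q%:Z * e j.
  by rewrite mulrC divzK ?dvdz_fermat // subrKC.
pose E := \sum_(1 <= j < q) e j * (j ^ (q - 2))%N%:Z.
exists (1 - 2%:R * E) => k kq.
have pairE j l : k == j * l %[mod q] ->
    (q%:Z ^+ 2 %| (j * l)%N%:Z - (k%:Z ^+ q - q%:Z * (e j * l%:Z + e l * j%:Z)))%Z.
  move=> kjl.
  have -> : (j * l)%N%:Z - (k%:Z ^+ q - q%:Z * (e j * l%:Z + e l * j%:Z)) =
      ((j * l)%N%:Z ^+ q - k%:Z ^+ q) - q%:Z ^+ 2 * (e j * e l).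
    by rewrite PoszM exprMn !ee; ring.
  apply: rpredB; last exact: dvdz_mulr.
  by apply: dvdz_expq_sub => //; rewrite -eqz_mod_dvd eq_sym !modz_nat eqz_nat.
(* The pairs (j, l) and (l, j) occur together. *)
have cross : \sum_(1 <= j < q) \sum_(1 <= l < q | k == j * l %[mod q]) e l * j%:Z =
    \sum_(1 <= j < q) \sum_(1 <= l < q | k == j * l %[mod q]) e j * l%:Z.
  rewrite (exchange_big_dep xpredT) //=; apply: eq_bigr => j _.
  by apply: eq_bigl => l; rewrite mulnC.
pose T := \sum_(1 <= j < q) \sum_(1 <= l < q | k == j * l %[mod q]) e j * l%:Z.
have TE : (q %| T - k%:Z * E)%Z.
  rewrite /T /E mulr_sumr -sumrB big_nat; apply: rpred_sum => j jq.
  rewrite sum_quotq // mulrCA -mulrBr dvdz_mull // -PoszM -eqz_mod_dvd.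
  by rewrite !modz_nat eqz_nat modn_mod.
have big : (q%:Z ^+ 2 %| pair_sum k - ((q%:Z - 1) * k%:Z ^+ q - q%:Z * (2%:R * T)))%Z.
  have -> : (q%:Z - 1) * k%:Z ^+ q - q%:Z * (2%:R * T) =
     \sum_(1 <= j < q) \sum_(1 <= l < q | k == j * l %[mod q])
       (k%:Z ^+ q - q%:Z * (e j * l%:Z + e l * j%:Z)).
    have -> : (q%:Z - 1) * k%:Z ^+ q = \sum_(1 <= j < q)
        \sum_(1 <= l < q | k == j * l %[mod q]) k%:Z ^+ q.
      rewrite big_nat (eq_bigr (fun=> k%:Z ^+ q)) => [|j jq]; last by rewrite sum_quotq.
      by rewrite -big_nat sumr_const_nat -mulr_natl natrB // natz.
    rewrite mulr_natl mulr2n {2}/T -cross -big_split mulr_sumr -sumrB.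
    apply: eq_bigr => j _; rewrite -big_split mulr_sumr -sumrB.
    by apply: eq_bigr.
  rewrite /pair_sum -sumrB; apply: rpred_sum => j _.
  by rewrite -sumrB; apply: rpred_sum => l; exact: pairE.
have -> : pair_sum k + k%:Z ^+ q - q%:Z * (k%:Z * (1 - 2%:R * E)) =
   pair_sum k - ((q%:Z - 1) * k%:Z ^+ q - q%:Z * (2%:R * T))
   + q%:Z * (k%:Z ^+ q - k%:Z - 2%:R * (T - k%:Z * E)) by ring.
by rewrite rpredD // expr2 dvdz_mul // rpredB ?dvdz_fermat // dvdz_mull.
Qed.

(** This is k times the coefficient of X^k in the truncation at t = q of
    sum_t a^t (1 - X)^t / t. *)
Definition binsum (a : int) (k : nat) : int :=
  (-1) ^+ k * \sum_(1 <= t < q.+1) a ^+ t * 'C(t.-1, k.-1)%:R.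

(** The alternating sum of the binomials of t - 1 vanishes for t > 1; only t = 1 and
    t = q, where the term k = q is missing, contribute. *)
Lemma sum_binsum a : \sum_(1 <= k < q) binsum a k = a ^+ q - a.
Proof.
have q0 := prime_gt0 q_prime.
have alt t : (0 < t)%N -> \sum_(0 <= k < t.+1) (-1) ^+ k * 'C(t, k)%:R = 0 :> int.
  move=> t0; rewrite big_mkord.
  have := exprDn (1 : int) (-1) t; rewrite subrr expr0n gtn_eqF // mulr0n => E; rewrite [RHS]E.
  by apply: eq_bigr => i _; rewrite expr1n mul1r mulr_natr.
rewrite /binsum.
under eq_bigr do rewrite mulr_sumr.
rewrite exchange_big /=.
have inner t : (t < q.-1)%N ->
    \sum_(1 <= k < q) (-1) ^+ k * 'C(t, k.-1)%:R = - (t == 0%N)%:R :> int.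
  move=> tq; rewrite big_add1 /=.
  rewrite (@big_cat_nat _ _ _ t.+1) //=.
  rewrite [X in _ + X]big_nat [X in _ + X]big1 => [|k /andP[k1 _]].
    under eq_bigr do rewrite exprS mulN1r mulNr.
    rewrite sumrN addr0; congr (- _).
    case: t tq => [|t] _; first by rewrite big_nat1 expr0 bin0.
    by rewrite alt.
  by rewrite bin_small ?mulr0.
have -> : \sum_(1 <= t < q.+1) \sum_(1 <= k < q) (-1) ^+ k * (a ^+ t * 'C(t.-1, k.-1)%:R) =
    \sum_(1 <= t < q.+1) a ^+ t * \sum_(1 <= k < q) (-1) ^+ k * 'C(t.-1, k.-1)%:R.
  by apply: eq_bigr => t _; rewrite mulr_sumr; apply: eq_bigr => k _; rewrite mulrCA.
rewrite big_nat_recr //= (big_ltn (ltnW q_gt2)) inner; last by lia.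
rewrite big_nat big1 => [|t /andP[t1 tq]]; last first.
  rewrite inner; last by lia.
  by rewrite gtn_eqF ?oppr0 ?mulr0 //; lia.
rewrite addr0 mulrN1 expr1 addrC; congr (_ + _).
rewrite -[RHS]mulr1; congr (_ * _).
have q1 : (0 < q.-1)%N by lia.
have := alt q.-1 q1; rewrite big_nat_recr //= binn sign_predq // mulr1 big_add1 /=.
move/eqP; rewrite addr_eq0 => /eqP S1.
under eq_bigr do rewrite exprS mulN1r mulNr.
by rewrite sumrN S1 opprK.
Qed.

Lemma Zloc_int (a : int) : Zloc q a%:~R.
Proof.
exists a, 1; split; last by rewrite divr1.
by rewrite -[(_ %| _)%Z]/(q %| 1)%N dvdn1 gtn_eqF // prime_gt1.
Qed.

Lemma ZlocD x y : Zloc q x -> Zloc q y -> Zloc q (x + y).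
Proof.
move=> [a [s [qs ->]]] [b [t [qt ->]]].
have nz z : ~~ (q %| z)%Z -> z%:~R != 0 :> rat.
  by apply: contraNneq => /eqP; rewrite intr_eq0 => /eqP ->; rewrite dvdz0.
exists (a * t + b * s), (s * t); split; last by rewrite addf_div ?nz // rmorphD !rmorphM.
by rewrite dvdzE abszM Euclid_dvdM // negb_or -!dvdzE qs.
Qed.

Lemma ZlocM x y : Zloc q x -> Zloc q y -> Zloc q (x * y).
Proof.
move=> [a [s [qs ->]]] [b [t [qt ->]]].
exists (a * b), (s * t); split; last by rewrite mulf_div !rmorphM.
by rewrite dvdzE abszM Euclid_dvdM // negb_or -!dvdzE qs.
Qed.

Lemma ZlocV (k : nat) : (0 < k < q)%N -> Zloc q k%:R^-1.
Proof.
move=> /andP[k0 kq]; exists 1, k; split; last by rewrite mul1r.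
by rewrite -[(_ %| _)%Z]/(q %| k)%N gtnNdvd.
Qed.

Lemma Zloc_sum (I : Type) (r : seq I) (P : pred I) (F : I -> rat) :
  (forall i, P i -> Zloc q (F i)) -> Zloc q (\sum_(i <- r | P i) F i).
Proof.
move=> ZF; apply: big_rec => [|i x Pi Zx]; first exact: (Zloc_int 0).
by apply: ZlocD => //; apply: ZF.
Qed.

Lemma fq_eval (x : rat) :
  (fq q).[x] = \sum_(1 <= t < q.+1) (fq_sum q t)%:~R / t%:R * x ^+ t.
Proof.
by rewrite horner_sum; apply: eq_bigr => t _; rewrite hornerZ hornerXn.
Qed.

Lemma fq_sumE t :
  fq_sum q t = \sum_(1 <= k < q) (-1) ^+ k * 'C(t, k)%:R * pair_sum k.
Proof.
rewrite /fq_sum exchange_big; apply: eq_bigr => k _ /=.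
rewrite mulr_sumr; apply: eq_bigr => j _; rewrite mulr_sumr; apply: eq_bigr => l _.
by rewrite !PoszM -!natz !natz; ring.
Qed.

Lemma kummer_coef_expand s : (s < q)%N -> s.+1%:R * kummer_coef q s =
  - (-1) ^+ s * \sum_(1 <= k < q.+1) (-1) ^+ k * 'C(s.+1, k)%:R * k%:R ^+ q.
Proof.
move=> sq; have q0 := prime_gt0 q_prime.
have E k : moment q ((-1) ^+ (s.+1 - k) * 'X^k *+ 'C(s.+1, k)) =
    (-1) ^+ (s.+1 - k) * 'C(s.+1, k)%:R * k%:R ^+ q.
  rewrite -momentXn -momentZ; congr moment.
  rewrite -mul_polyC polyCM polyC_exp polyCN polyC_natr -mulr_natr; ring.
rewrite kummer_coefE // addrC exprDn linear_sum /= mulr_sumr.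
rewrite -(big_mkord xpredT (fun i => moment q ((-1) ^+ (s.+1 - i) * 'X^i *+ 'C(s.+1, i)))).
rewrite big_ltn // E expr0n (gtn_eqF q0) mulr0n mulr0 add0r.
rewrite [RHS](@big_cat_nat _ _ _ s.+2) //= [X in _ + X]big_nat [X in _ + X]big1 ?addr0.
  apply: eq_big_nat => k /andP[k1 ks]; rewrite E !mulrA; congr (_ * _ * _).
  have -> : - (-1) ^+ s = (-1) ^+ s.+1 :> int by rewrite exprS mulN1r.
  have -> : s.+1 = (s.+1 - k + k)%N by rewrite subnK.
  by rewrite addnK exprD -mulrA -exprD addnn -mul2n exprM sqrrN !expr1n mulr1.
by move=> k /andP[sk _]; rewrite bin_small // mulr0 mul0r mulr0.
Qed.

(** In both numbers collect the terms by k, using 'C(t, k) / t = 'C(t - 1, k - 1) / k.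
    The coefficients of [binsum a k] / k are [pair_sum k] in f_q(a) and - k^q in
    [kummer a].  By [pair_sum_linear] they differ by q k C modulo q^2, so the
    difference of the two numbers is q C times [sum_binsum], which is divisible
    by q.  The term k = q of [kummer a] is a^q q^(q - 1), a multiple of q^2. *)
Lemma fq_kummer (a : int) : q2Zloc q ((fq q).[a%:~R] - (kummer q a)%:~R).
Proof.
have q0 := prime_gt0 q_prime.
have [C HC] := pair_sum_linear.
have [B HB] := dvdzP (dvdz_fermat q_prime a).
have [r Hr] : exists r : nat -> int, forall k, (0 < k < q)%N ->
    pair_sum k + k%:Z ^+ q = q%:Z * (k%:Z * C) + q%:Z ^+ 2 * r k.
  exists (fun k => (pair_sum k + k%:Z ^+ q - q%:Z * (k%:Z * C)) %/ (q%:Z ^+ 2))%Z.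
  by move=> k kq; rewrite [q%:Z ^+ 2 * _]mulrC divzK ?HC // subrKC.
exists (C%:~R * B%:~R + \sum_(1 <= k < q) (r k * binsum a k)%:~R / k%:R
    + (- a ^+ q * q%:Z ^+ (q - 3))%:~R).
  apply: ZlocD; last exact: Zloc_int.
  apply: ZlocD; first by rewrite -rmorphM; exact: Zloc_int.
  rewrite big_nat; apply: Zloc_sum => k kq.
  by apply: ZlocM; [exact: Zloc_int | exact: ZlocV].
have gE : (kummer q a)%:~R = - \sum_(1 <= t < q.+1) a%:~R ^+ t / t%:R *
    (\sum_(1 <= k < q.+1) (-1) ^+ k * 'C(t, k)%:R * k%:R ^+ q) :> rat.
  rewrite big_add1 /= big_mkord /kummer rmorph_sum -sumrN; apply: eq_bigr => s _.
  have s1 : (s.+1%:R : rat) != 0 by rewrite pnatr_eq0.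
  apply: (mulfI s1).
  have := kummer_coef_expand (ltn_ord s) => /(congr1 (intr : int -> rat)).
  rewrite rmorphM /= !rmorphM rmorph_nat /= => us.
  rewrite mulrCA us.
  have -> : (\sum_(1 <= k < q.+1) (-1) ^+ k * 'C(s.+1, k)%:R * k%:R ^+ q)%:~R =
      \sum_(1 <= k < q.+1) (-1) ^+ k * 'C(s.+1, k)%:R * k%:R ^+ q :> rat.
    rewrite rmorph_sum; apply: eq_bigr => k _.
    by rewrite !(rmorphM, rmorphXn, rmorph_nat, rmorphN1).
  have sg : (-1) ^+ s * (-1) ^+ s = 1 :> rat by rewrite -expr2 sqrr_sign.
  rewrite rmorphN !rmorphXn rmorphN1 /=.
  have -> : forall S, (-1) ^+ s * a%:~R ^+ s.+1 * (- (-1) ^+ s * S) =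
      - ((-1) ^+ s * (-1) ^+ s) * a%:~R ^+ s.+1 * S :> rat by move=> S; ring.
  by rewrite sg; move: (s.+1%:R) s1 => c c0; field.
have tE t k : (0 < t)%N -> (0 < k)%N -> 'C(t, k)%:R / t%:R = 'C(t.-1, k.-1)%:R / k%:R :> rat.
  case: t k => [//|t] [//|k] _ _ /=.
  apply/eqP; rewrite eqr_div ?pnatr_eq0 // -!natrM eqr_nat mulnC.
  by rewrite -[t in 'C(t, k)]/(t.+1.-1) [('C(t.+1.-1, k) * _)%N]mulnC mul_bin_diag.
have kE k : (0 < k)%N ->
   \sum_(1 <= t < q.+1) a%:~R ^+ t / t%:R * ((-1) ^+ k * 'C(t, k)%:R) =
     (binsum a k)%:~R / k%:R :> rat.
  move=> k0; rewrite /binsum rmorphM rmorph_sum mulr_sumr mulr_suml.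
  apply: eq_big_nat => t /andP[t0 _].
  rewrite rmorphM /= !rmorphXn rmorph_nat /=.
  have -> : a%:~R ^+ t / t%:R * ((-1) ^+ k * 'C(t, k)%:R) =
     (-1) ^+ k * a%:~R ^+ t * ('C(t, k)%:R / t%:R) :> rat by ring.
  by rewrite tE //; ring.
have bq : binsum a q = - a ^+ q.
  rewrite /binsum big_nat_recr //= big_nat big1 => [|t /andP[t1 tq]].
    by rewrite sign_q // binn; ring.
  by rewrite bin_small ?mulr0 //; lia.
have diff : (fq q).[a%:~R] - (kummer q a)%:~R =
    \sum_(1 <= k < q) (binsum a k)%:~R / k%:R * (pair_sum k + k%:Z ^+ q)%:~R
    + (binsum a q)%:~R / q%:R * q%:R ^+ q.
  rewrite fq_eval gE opprK -big_split /=.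
  rewrite (eq_bigr (fun t => \sum_(1 <= k < q)
       a%:~R ^+ t / t%:R * ((-1) ^+ k * 'C(t, k)%:R) * (pair_sum k + k%:Z ^+ q)%:~R
     + a%:~R ^+ t / t%:R * ((-1) ^+ q * 'C(t, q)%:R) * q%:R ^+ q)).
    rewrite big_split /= exchange_big /= -mulr_suml kE //; congr (_ + _).
    by apply: eq_big_nat => k /andP[k0 _]; rewrite -mulr_suml kE.
  move=> t _; rewrite big_nat_recr //= mulrDr addrA fq_sumE; congr (_ + _); last by ring.
  rewrite -[X in X + _]mulrA [X in X + _]mulrC [_^-1 * _]mulrC rmorph_sum /=.
  rewrite !mulr_sumr -big_split; apply: eq_bigr => k _ /=.
  by rewrite !(rmorphM, rmorphD, rmorphXn, rmorph_nat) /= ?rmorphN1; ring.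
rewrite diff bq.
rewrite (eq_big_nat _ _ (F2 := fun k => q%:R * C%:~R * (binsum a k)%:~R
   + (q ^ 2)%:R * ((r k * binsum a k)%:~R / k%:R))) => [|k kq].
  rewrite big_split /= -!mulr_sumr -rmorph_sum sum_binsum HB /=.
  have -> : q%:R ^+ q = q%:R ^+ 3 * q%:R ^+ (q - 3) :> rat.
    by rewrite -exprD; congr (_ ^+ _); lia.
  rewrite natrX !(rmorphM, rmorphN, rmorphXn) /= -pmulrn.
  by field; rewrite pnatr_eq0 -lt0n.
have k1 : (k%:R : rat) != 0 by rewrite pnatr_eq0 -lt0n; case/andP: kq.
rewrite Hr // natrX !(rmorphM, rmorphD, rmorphXn) /= -!pmulrn.
by field.
Qed.

End OddPrime.

(** * The ring Z[zeta] *)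

Definition ev (z : algC) (h : {poly int}) : algC := (map_poly intr h).[z].

Lemma ev_additive z : zmod_morphism (ev z).
Proof. by move=> F G; rewrite /ev rmorphB hornerD hornerN. Qed.
HB.instance Definition _ z :=
  GRing.isZmodMorphism.Build {poly int} algC (ev z) (ev_additive z).

Lemma ev_multiplicative z : monoid_morphism (ev z).
Proof. by split=> [|F G]; rewrite /ev ?rmorph1 ?hornerC // rmorphM hornerM. Qed.
HB.instance Definition _ z :=
  GRing.isMonoidMorphism.Build {poly int} algC (ev z) (ev_multiplicative z).

Lemma evX z : ev z 'X = z.
Proof. by rewrite /ev map_polyX hornerX. Qed.

Lemma evC z c : ev z c%:P = c%:~R.
Proof. by rewrite /ev map_polyC hornerC. Qed.

Lemma evZ z c h : ev z (c *: h) = c%:~R * ev z h.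
Proof. by rewrite -mul_polyC rmorphM /= evC. Qed.

Lemma evXn z k : ev z 'X^k = z ^+ k.
Proof. by rewrite rmorphXn /= evX. Qed.

Lemma evD z F G : ev z (F + G) = ev z F + ev z G. Proof. exact: rmorphD. Qed.
Lemma evN z F : ev z (- F) = - ev z F. Proof. exact: rmorphN. Qed.
Lemma evM z F G : ev z (F * G) = ev z F * ev z G. Proof. exact: rmorphM. Qed.
Lemma ev1 z : ev z 1 = 1. Proof. exact: rmorph1. Qed.
Definition evE := (evD, evN, evM, ev1, evZ, evC, evXn, evX).

Lemma ev_comp z h k : ev z (h \Po 'X^k) = ev (z ^+ k) h.
Proof. by rewrite /ev map_comp_poly map_polyXn horner_comp hornerXn. Qed.

Lemma conjC_root1 n (x : algC) : (0 < n)%N -> x ^+ n = 1 -> x^* = x ^+ n.-1.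
Proof.
move=> n0 xn; have xx : x * x^* = 1.
  have : `|x| ^+ n = 1 by rewrite -normrX xn normr1.
  by move/eqP; rewrite pexpr_eq1 // -normCK => /eqP ->; rewrite expr1n.
by rewrite -[LHS]mul1r -xn -[in x ^+ n](prednK n0) exprSr -mulrA xx mulr1.
Qed.

Section Cyclotomic.

Variable q : nat.
Hypothesis q_prime : prime q.
Hypothesis q_gt2 : (2 < q)%N.
Variable z : algC.
Hypothesis z_prim : q.-primitive_root z.
Local Notation Phi := (cyclo q).
Local Notation ev := (ev z).

Lemma sum_powers k : \sum_(i < q) (z ^+ k) ^+ i = if (q %| k)%N then q%:R else 0.
Proof.
case: ifP => qk.
  have /eqP -> : z ^+ k == 1 by rewrite -(prim_order_dvd z_prim).
  by under eq_bigr do rewrite expr1n; rewrite sumr_const card_ord.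
have : z ^+ k - 1 != 0 by rewrite subr_eq0 -(prim_order_dvd z_prim) qk.
move/mulfI; apply; rewrite mulr0 -subrX1 exprAC (prim_expr_order z_prim) expr1n subrr //.
Qed.

Lemma ev_cyclo : ev Phi = 0.
Proof.
have := sum_powers 1; rewrite dvdn1 gtn_eqF ?prime_gt1 // => <-.
by rewrite rmorph_sum; apply: eq_bigr => i _; rewrite /= evXn.
Qed.

(** The two factorizations of X^q - 1 agree. *)
Lemma cyclo_Cyclotomic : Phi = 'Phi_q.
Proof.
have y0 : ('X - 1 : {poly int}) != 0 by rewrite -polyC1 polyXsubC_eq0.
have P1 : 'Phi_1 = 'X - 1.
  by have := @prod_Cyclotomic 1 isT; rewrite big_cons big_nil mulr1 expr1.
apply: (mulfI y0); rewrite X1_cyclo -(prod_Cyclotomic (prime_gt0 q_prime)).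
have -> : divisors q = [:: 1%N; q].
  apply: (irr_sorted_eq ltn_trans ltnn (sorted_divisors_ltn q)) => [|d].
    by rewrite /= prime_gt1.
  rewrite -dvdn_divisors ?prime_gt0 // !inE.
  have [_ dq] := primeP q_prime.
  by apply/idP/idP => [/dq|/orP[]/eqP->].
by rewrite !big_cons big_nil mulr1 P1.
Qed.

Lemma cyclo_monic : Phi \is monic.
Proof. by rewrite cyclo_Cyclotomic Cyclotomic_monic. Qed.

Lemma size_cyclo : size Phi = q.
Proof. by rewrite cyclo_Cyclotomic size_Cyclotomic totient_prime // prednK ?prime_gt0. Qed.

Lemma ev_mod h : exists R W, [/\ h = R + Phi * W & (size R < q)%N].
Proof.
exists (Pdiv.Ring.rmodp h Phi), (Pdiv.Ring.rdivp h Phi); split.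
  by rewrite addrC mulrC -Pdiv.RingMonic.rdivp_eq // cyclo_monic.
by rewrite -[X in (_ < X)%N]size_cyclo Pdiv.Ring.ltn_rmodp monic_neq0 // cyclo_monic.
Qed.

(** The cyclotomic polynomial is the minimal polynomial of zeta, and it is monic,
    so the division is possible over the integers. *)
Lemma ev_eq0 h : ev h = 0 -> exists W, h = Phi * W.
Proof.
have [R [W [-> sR]]] := ev_mod h.
rewrite rmorphD rmorphM /= ev_cyclo mul0r addr0 => evR.
exists W; suff -> : R = 0 by rewrite add0r.
have [P [EP _ rootP]] := minCpolyP z.
have ratr_int (F : {poly int}) :
    map_poly intr F = map_poly ratr (map_poly intr F : {poly rat}) :> {poly algC}.
  by rewrite -map_poly_comp; apply: eq_map_poly => x; rewrite /= ratr_int.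
have : P %| map_poly intr R by rewrite -rootP -ratr_int rootE; apply/eqP.
have -> : P = map_poly intr Phi.
  apply: (map_poly_inj (ratr : {rmorphism rat -> algC})).
  by rewrite -EP -ratr_int (minCpoly_cyclotomic z_prim) cyclo_Cyclotomic -Cintr_Cyclotomic.
have [-> // | R0] := eqVneq R 0.
move/dvdp_leq; rewrite !size_map_inj_poly ?rmorph0 //; try exact: intr_inj.
rewrite size_cyclo map_poly_eq0_id0 ?intr_eq0 ?lead_coef_eq0 // leqNgt sR.
by move=> /(_ R0).
Qed.

Lemma sum_sqr_eq1 (b : 'I_q -> int) : \sum_i b i ^+ 2 = 1 ->
  exists k, [/\ b k = 1 \/ b k = -1 & forall i, i != k -> b i = 0].
Proof.
move=> b1.
have [k bk] : exists k, b k != 0.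
  apply/existsP; apply: contra_eqT b1; rewrite negb_exists => /forallP b0.
  by rewrite big1 // => i _; have := b0 i; rewrite negbK => /eqP ->.
have bk1 : 1 <= b k ^+ 2 by rewrite -gtz0_ge1 exprn_even_gt0.
have rest : \sum_(i | i != k) b i ^+ 2 = 0.
  apply/eqP; rewrite eq_le sumr_ge0 ?andbT => [|i _]; last exact: sqr_ge0.
  by move: b1; rewrite (bigD1 k) //= => b1; rewrite -(lerD2l (b k ^+ 2)) b1 addr0.
have bk2 : b k ^+ 2 = 1 by move: b1; rewrite (bigD1 k) //= rest addr0.
exists k; split.
  by move/eqP: bk2; rewrite sqrf_eq1 => /orP[]/eqP->; [left|right].
move=> i ik; move/eqP: rest; rewrite psumr_eq0 => [|j _]; last exact: sqr_ge0.
by move/allP/(_ i (mem_index_enum i)); rewrite ik sqrf_eq0 => /eqP.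
Qed.


Lemma sqr_mod1 (s : int) : (q %| s ^+ 2 - 1)%Z ->
  exists c e : int, s = e + q%:Z * c /\ (e = 1 \/ e = -1).
Proof.
rewrite -[X in _ - X](expr1n _ 2) subr_sqr dvdzE abszM Euclid_dvdM // -!dvdzE.
case/orP => /dvdzP[c E]; [exists c, 1 | exists c, (-1)]; split; try by [left | right].
  by rewrite mulrC -E subrKC.
by rewrite mulrC -E addrC addrK.
Qed.

(** Write the number as sum_i a_i zeta^i.  All conjugates have absolute value one,
    so the sum of their squares is q sum a_i^2 - (sum a_i)^2 = q - 1.  As
    sum zeta^i = 0, all a_i may be shifted by the same integer c so that their
    sum becomes +- 1; then sum a_i^2 = 1 and a single a_i is nonzero. *)
Lemma ev_root_unity h : ev h * (ev h)^* = 1 ->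
  exists k (e : int), (e = 1 \/ e = -1) /\ ev h = e%:~R * z ^+ k.
Proof.
have q0 := prime_gt0 q_prime.
have [R [W [Eh sR]]] := ev_mod h.
pose a i := R`_i.
have -> : ev h = ev R by rewrite Eh rmorphD rmorphM /= ev_cyclo mul0r addr0.
have {}ER : R = \sum_(i < q) a i *: 'X^i.
  rewrite -[LHS]coefK poly_def -(big_mkord xpredT (fun i => R`_i *: 'X^i)).
  rewrite -(big_mkord xpredT (fun i => a i *: 'X^i)).
  rewrite (@big_cat_nat _ _ _ (size R) 0 q) //=; last exact: ltnW.
  rewrite [X in _ = _ + X]big_nat [X in _ = _ + X]big1 ?addr0 // => i /andP[si _].
  by rewrite /a nth_default // scale0r.
pose R' : {poly int} := \sum_(i < q) a i *: 'X^(q - i).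
have conjR : (ev R)^* = ev R'.
  rewrite ER !rmorph_sum; apply: eq_bigr => i _ /=.
  rewrite !evZ !evXn rmorphM rmorph_int rmorphXn /=; congr (_ * _).
  rewrite (conjC_root1 q0 (prim_expr_order z_prim)) -exprM.
  apply/eqP; rewrite (eq_prim_root_expr z_prim).
  have iq := ltn_ord i.
  rewrite -(eqn_modDr i) subnK ?(ltnW iq) // addnC -mulSn prednK //.
  by rewrite modnn modnMr.
rewrite conjR => uu.
have [V EV] : exists V, R * R' - 1 = Phi * V.
  by apply: ev_eq0; rewrite rmorphB rmorphM rmorph1 /= uu subrr.
pose s := \sum_(i < q) a i.
have R1 : R.[1] = s.
  by rewrite ER horner_sum; apply: eq_bigr => i _; rewrite !hornerE expr1n mulr1.
have R'1 : R'.[1] = s.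
  by rewrite horner_sum; apply: eq_bigr => i _; rewrite !hornerE expr1n mulr1.
have s2 : s ^+ 2 = 1 + q%:Z * V.[1].
  have := congr1 (horner^~ 1) EV; rewrite !hornerE /= R1 R'1 cyclo1 => /eqP.
  by rewrite subr_eq addrC => /eqP.
(* Sum R R' over all q-th roots of unity: its value is 1 at the primitive ones and
   s^2 at 1. *)
have trace : q%:Z * \sum_(i < q) a i ^+ 2 = (q%:Z - 1) + s ^+ 2.
  pose S := \sum_(j < q) (map_poly intr R).[z ^+ j] * (map_poly intr R').[z ^+ j].
  have Sj (j : 'I_q) : (map_poly intr R).[z ^+ j] * (map_poly intr R').[z ^+ j] =
      if (j == 0 :> nat)%N then (s ^+ 2)%:~R else 1.
    case: ifP => [/eqP -> | j0].
      rewrite expr0 -(rmorph1 intr) !horner_map /= R1 R'1 expr2 rmorphM //.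
    have := congr1 (fun h => (map_poly intr h).[z ^+ j]) EV.
    rewrite rmorphB !rmorphM /= rmorph1 !hornerE /= => /eqP.
    rewrite subr_eq => /eqP ->.
    have -> : (map_poly intr Phi).[z ^+ j] = 0.
      have jq : ~~ (q %| j)%N by rewrite gtnNdvd ?lt0n ?j0.
      have := sum_powers j; rewrite ifN // => <-.
      rewrite rmorph_sum horner_sum.
      by apply: eq_bigr => i _; rewrite /= map_polyXn hornerXn.
    by rewrite mul0r add0r.
  have S1 : S = ((q%:Z - 1) + s ^+ 2)%:~R.
    rewrite /S (bigD1 (Ordinal q0)) // Sj /= (eq_bigr (fun=> 1)) => [|j j0]; last first.
      by rewrite Sj ifN.
    rewrite sumr_const cardC1 card_ord addrC rmorphD; congr (_ + _).
    by rewrite -subn1 natrB // rmorphB.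
  apply: (@intr_inj algC); rewrite -S1 /S.
  transitivity (\sum_(j < q) \sum_(i < q) \sum_(k < q)
     (a i * a k)%:~R * (z ^+ (i + (q - k))) ^+ j); last first.
    apply: eq_bigr => j _; rewrite ER !rmorph_sum !horner_sum mulr_suml.
    apply: eq_bigr => i _; rewrite mulr_sumr; apply: eq_bigr => k _ /=.
    rewrite -!mul_polyC !rmorphM /= !map_polyC !map_polyXn !hornerM !hornerC !hornerXn /=.
    by rewrite -!exprM [(_ * j)%N]mulnC mulnDr exprD; ring.
  rewrite exchange_big /= mulr_sumr rmorph_sum; apply: eq_bigr => i _ /=.
  rewrite exchange_big (bigD1 i) //= -mulr_sumr sum_powers subnKC ?(ltnW (ltn_ord i)) // dvdnn.
  rewrite big1 ?addr0 => [|k ki]; first by rewrite rmorphM /= expr2 mulrC -pmulrn.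
  rewrite -mulr_sumr sum_powers ifN ?mulr0 //.
  apply: contra ki => qik; rewrite -val_eqE /= eq_sym.
  rewrite -(@modn_small i q) // -(@modn_small k q) //.
  by rewrite -(eqn_modDr (q - k)) subnKC ?(ltnW (ltn_ord k)) // modnn.
have [c [e [se e1]]] : exists c e : int, s = e + q%:Z * c /\ (e = 1 \/ e = -1).
  by apply: sqr_mod1; rewrite s2 addrAC subrr add0r dvdz_mulr.
have e2 : e ^+ 2 = 1 by case: e1 => ->.
have : \sum_(i < q) (a i - c) ^+ 2 = 1.
  have qz : q%:Z != 0 by rewrite eqz_nat -lt0n.
  apply: (mulfI qz).
  rewrite (eq_bigr (fun i : 'I_q => a i ^+ 2 - (2%:R * c) * a i + c ^+ 2)) => [|i _];
    last by ring.
  rewrite big_split sumrB /= -mulr_sumr sumr_const card_ord !mulrDr trace -/s mulr1.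
  rewrite -mulr_natl natz.
  have : e ^+ 2 = (s - q%:Z * c) ^+ 2 by rewrite se addrK.
  rewrite e2 => E.
  transitivity (q%:Z - 1 + (s - q%:Z * c) ^+ 2); first by ring.
  by rewrite -E subrK.
move/sum_sqr_eq1 => [k [bk bi]].
exists k, (a k - c); split=> //; rewrite -evXn -evZ.
have EvR : ev R = ev (\sum_(i < q) (a i - c) *: 'X^i).
  have -> : \sum_(i < q) (a i - c) *: 'X^i = R - c *: Phi.
    rewrite ER -[Phi]/(\sum_(i < q) 'X^i) scaler_sumr -sumrB; apply: eq_bigr => i _.
    by rewrite scalerBl.
  by rewrite rmorphB /= evZ ev_cyclo mulr0 subr0.
rewrite EvR (bigD1 k) //= big1 ?addr0 // => i ik.
by rewrite bi // scale0r.
Qed.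

Lemma Aint_z : z \in Aint.
Proof. exact: Aint_prim_root z_prim. Qed.

Lemma Aint_ev h : ev h \in Aint.
Proof.
rewrite -[ev h]/((map_poly intr h).[z]) -[map_poly _ h]coefK horner_poly.
apply: rpred_sum => i _.
by rewrite rpredM ?rpredX ?Aint_z // coef_map Aint_int.
Qed.

Lemma lam_neq0 : 1 - z != 0.
Proof.
rewrite subr_eq0 eq_sym -[z]expr1 -(prim_order_dvd z_prim) dvdn1.
by rewrite gtn_eqF ?prime_gt1.
Qed.

Lemma lam_predq : exists e : {poly int},
  (1 - z) ^+ q.-1 = q%:R * ((z - 1) * ev e - 1).
Proof.
have [e Ee e1] := X1_pow_cyclo q_prime q_gt2.
have [e' Ee'] := poly_divX e 1; exists e'.
have -> : (z - 1) * ev e' - 1 = ev e.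
  by rewrite {1}Ee' e1 !evE; ring.
have := congr1 ev Ee.
rewrite rmorphXn rmorphB rmorphD rmorph1 /= evX evZ ev_cyclo add0r -pmulrn => <-.
by rewrite -opprB exprNn sign_predq // mul1r.
Qed.

(** Taking (q - 1)-st powers, c^(q - 1) / q is a rational algebraic integer. *)
Lemma lam_dvd_int (c : int) y : y \in Aint -> c%:~R = (1 - z) * y -> (q %| c)%Z.
Proof.
move=> Ay cy; have [e le] := lam_predq.
have q1 : (0 < q.-1)%N by lia.
set w := (z - 1) * ev e - 1 in le.
have Aw : w \in Aint by rewrite rpredB ?rpredM ?Aint_ev ?rpredB ?rpred1 ?Aint_z.
have qc : c%:~R ^+ q.-1 = q%:R * (w * y ^+ q.-1) :> algC.
  by rewrite cy exprMn le mulrA.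
have qR : (q%:R : algC) != 0 by rewrite pnatr_eq0 -lt0n prime_gt0.
have : w * y ^+ q.-1 \in Num.int.
  apply: Cint_rat_Aint; last by rewrite rpredM ?rpredX.
  have -> : w * y ^+ q.-1 = c%:~R ^+ q.-1 / q%:R by rewrite qc mulrAC divff ?mul1r.
  by rewrite rpred_div ?rpredX ?rpred_int ?rpred_nat.
move/intrP => [d Ed]; move: qc; rewrite Ed => qc.
have : (q %| c ^+ q.-1)%Z.
  apply/dvdzP; exists d; apply: (@intr_inj algC).
  by rewrite rmorphXn rmorphM /= qc mulrC.
by rewrite !(dvdz_pcharf (pchar_Fp q_prime)) rmorphXn expf_eq0 => /andP[].
Qed.

Lemma q_lam : exists w, q%:R = (1 - z) * ev w.
Proof.
have q0 := prime_gt0 q_prime.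
have [w /(congr1 ev)] := poly_divX Phi 1.
rewrite cyclo1 ev_cyclo !evE => E; exists w.
by apply/eqP; rewrite -subr_eq0 [X in _ == X]E -pmulrn; apply/eqP; ring.
Qed.

(** Z[zeta] is closed under the division by lambda among all algebraic integers:
    if lambda divides h(zeta) then q divides h(1), and q is lambda times an
    element of Z[zeta]. *)
Lemma lam_descent s h y : y \in Aint -> ev h = (1 - z) ^+ s * y ->
  exists h', y = ev h'.
Proof.
elim: s h y => [|s IH] h y Ay; first by rewrite mul1r => <-; exists h.
rewrite exprSr -mulrA => E.
have Aly : (1 - z) * y \in Aint by rewrite rpredM // rpredB ?rpred1 ?Aint_z.
have [h1 E1] := IH _ _ Aly E.
have [h2 Eh2] := poly_divX h1 1.
have E2 : (1 - z) * y = h1.[1]%:~R - (1 - z) * ev h2.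
  by rewrite E1 {1}Eh2 !evE; ring.
have q1 : (q %| h1.[1])%Z.
  apply: (@lam_dvd_int _ (y + ev h2)); first by rewrite rpredD ?Aint_ev.
  by rewrite mulrDr E2 subrK.
have [w Ew] := q_lam; have [c Ec] := dvdzP q1.
exists (c *: w - h2); apply: (mulfI lam_neq0).
rewrite E2 Ec rmorphM /= -pmulrn Ew rmorphB /= evZ; ring.
Qed.

(** Rewrite lambda^q and lambda^(q + 1) as q lambda and q lambda^2 times
    polynomials in zeta, with [lam_predq]. *)
Lemma unit_expand F (nu : int) y : y \in Aint ->
  ev F = 1 + nu%:~R * (1 - z) ^+ q + (1 - z) ^+ q.+1 * y ->
  exists A W, F = 1 + q%:Z *: (nu *: ('X - 1) + ('X - 1) ^+ 2 * A) + Phi * W.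
Proof.
move=> Ay EF; have q0 := prime_gt0 q_prime.
have [h Eh] : exists h, y = ev h.
  apply: (@lam_descent q.+1 (F - 1 - nu *: (1 - 'X) ^+ q)) => //.
  rewrite rmorphB rmorphB rmorph1 /= evZ rmorphXn rmorphB rmorph1 /= evX EF; ring.
have [e le] := lam_predq.
exists (h * (('X - 1) * e - 1) - nu *: e).
suff [W EW] : exists W, F - (1 + q%:Z *: (nu *: ('X - 1)
    + ('X - 1) ^+ 2 * (h * (('X - 1) * e - 1) - nu *: e))) = Phi * W.
  by exists W; rewrite -EW subrKC.
apply: ev_eq0.
have lq : (1 - z) ^+ q = (1 - z) * (q%:R * ((z - 1) * ev e - 1)).
  by rewrite -le -exprS prednK.
rewrite evD evN EF Eh exprS lq [ev (1 + _)]evD [ev (q%:Z *: _)]evZ [ev (_ + _)]evD.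
rewrite [ev (nu *: _)]evZ [ev (_ * _)]evM [ev (_ - nu *: _)]evD evN [ev (h * _)]evM.
rewrite rmorphXn /= !evE -pmulrn; ring.
Qed.

End Cyclotomic.

(** * The primes m - n zeta^k above p *)

Lemma reindex_range (R : Type) (idx : R) (op : Monoid.com_law idx) (n : nat)
    (s : nat -> nat) (F : nat -> R) :
  (forall i, (0 < i < n)%N -> (0 < s i < n)%N) ->
  (forall i j, (0 < i < n)%N -> (0 < j < n)%N -> s i = s j -> i = j) ->
  \big[op/idx]_(1 <= i < n) F (s i) = \big[op/idx]_(1 <= i < n) F i.
Proof.
move=> sP s_inj; have -> : \big[op/idx]_(1 <= i < n) F (s i) =
  \big[op/idx]_(j <- map s (index_iota 1 n)) F j by rewrite big_map.
apply: perm_big; set r := index_iota 1 n.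
have mr i : (i \in r) = (0 < i < n)%N by rewrite mem_index_iota.
have us : uniq (map s r).
  by rewrite map_inj_in_uniq ?iota_uniq // => i j; rewrite !mr; exact: s_inj.
have ss : {subset map s r <= r} by move=> _ /mapP[i ir ->]; rewrite mr sP // -mr.
have [_ eqs] := uniq_min_size us ss (eq_leq (esym (size_map s r))).
by rewrite uniq_perm ?iota_uniq.
Qed.

Lemma prime_Fp_neq0 (p q : nat) : prime p -> prime q -> p <> q ->
  (q%:R : 'F_p) != 0.
Proof.
by move=> p_pr q_pr pq; rewrite -(dvdn_pcharf (pchar_Fp p_pr)) dvdn_prime2 //; apply/eqP.
Qed.

Section Prime.

Variable q : nat.
Hypothesis q_prime : prime q.
Hypothesis q_gt2 : (2 < q)%N.
Variables (m n : int) (p : nat).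
Hypothesis p_def : p%:Z = \sum_(i < q) m ^+ i * n ^+ (q - 1 - i).
Hypothesis p_prime : prime p.
Hypothesis p_neq_q : p <> q.

Lemma homogeneous_sum (R : comPzRingType) (x y : R) :
  (x - y) * \sum_(i < q) x ^+ i * y ^+ (q - 1 - i) = x ^+ q - y ^+ q.
Proof.
rewrite -opprB mulNr -[RHS]opprB; congr (- _); rewrite subrXX subn1; congr (_ * _).
by apply: eq_bigr => i _; rewrite mulrC.
Qed.

Lemma p_charF : p \in [pchar 'F_p]. Proof. exact: pchar_Fp. Qed.

(** If p divides n then it divides m, and then p^(q - 1) divides p. *)
Lemma n_Fp_neq0 : (n%:~R : 'F_p) != 0.
Proof.
apply/negP => n0.
have : p%:Z%:~R == 0 :> 'F_p by rewrite -pmulrn pchar_Fp_0.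
have q0 := prime_gt0 q_prime.
have E : p%:Z = m ^+ q.-1 + n * \sum_(i < q.-1) m ^+ i * n ^+ (q.-1 - i.+1).
  rewrite p_def -[in LHS](prednK q0) big_ord_recr /= !subn1 /= subnn expr0 mulr1 addrC.
  rewrite mulr_sumr; congr (_ + _); apply: eq_bigr => i _.
  by rewrite -[(q.-1 - i)%N]prednK ?subn_gt0 // exprS -subnS mulrCA.
rewrite E rmorphD rmorphM /= (eqP n0) mul0r addr0 rmorphXn expf_eq0 => /andP[_ m0].
have /dvdzP[a Ea] : (p %| m)%Z by rewrite (dvdz_pcharf p_charF).
have /dvdzP[b Eb] : (p %| n)%Z by rewrite (dvdz_pcharf p_charF).
have : (p%:Z ^+ 2 %| p%:Z)%Z.
  rewrite [X in (_ %| X)%Z]p_def; apply: rpred_sum => i _.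
  rewrite Ea Eb !exprMn mulrACA -exprD.
  rewrite dvdz_mull //.
  have -> : (i + (q - 1 - i) = 2 + (q - 3))%N by have := ltn_ord i; lia.
  by rewrite exprD dvdz_mulr.
have p0 : p%:Z != 0 by rewrite eqz_nat -lt0n prime_gt0.
move=> /dvdzP[c Ec]; have : (p %| 1)%Z.
  by apply/dvdzP; exists c; apply: (mulIf p0); rewrite mul1r -mulrA.
by rewrite -[(_ %| _)%Z]/(p %| 1)%N dvdn1 gtn_eqF ?prime_gt1.
Qed.

Definition z_Fp : 'F_p := m%:~R / n%:~R.

Lemma z_FpM : z_Fp * n%:~R = m%:~R.
Proof. by rewrite /z_Fp divfK // n_Fp_neq0. Qed.

Lemma norm_Fp_eq0 : \sum_(i < q) m%:~R ^+ i * n%:~R ^+ (q - 1 - i) = 0 :> 'F_p.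
Proof.
transitivity (p%:Z%:~R : 'F_p); last by rewrite -pmulrn pchar_Fp_0.
by rewrite p_def rmorph_sum; apply: eq_bigr => i _; rewrite rmorphM !rmorphXn.
Qed.

(** Otherwise m = n in F_p, and then p = q n^(q - 1) there, which is not 0. *)
Lemma z_Fp_prim : q.-primitive_root z_Fp.
Proof.
have n0 := n_Fp_neq0.
have zq : z_Fp ^+ q = 1.
  apply: (mulIf (expf_neq0 q n0)); rewrite -exprMn z_FpM mul1r.
  apply/eqP; rewrite -subr_eq0 -(homogeneous_sum (m%:~R : 'F_p)).
  by rewrite norm_Fp_eq0 mulr0.
have z1 : z_Fp != 1.
  apply/eqP => z1; have mn : m%:~R = n%:~R :> 'F_p by rewrite -z_FpM z1 mul1r.
  have /eqP := norm_Fp_eq0; rewrite mn (eq_bigr (fun=> n%:~R ^+ q.-1)) => [|i _].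
    rewrite sumr_const card_ord -mulr_natl mulf_eq0.
    by rewrite (negbTE (prime_Fp_neq0 p_prime q_prime p_neq_q)) expf_eq0 (negbTE n0) andbF.
  by rewrite -exprD; congr (_ ^+ _); have := ltn_ord i; lia.
have [d d_prim dq] := prim_order_exists (prime_gt0 q_prime) zq.
have [_ /(_ _ dq)/orP[/eqP d1|/eqP <- //]] := primeP q_prime.
by move: (prim_expr_order d_prim) z1; rewrite d1 expr1 => ->; rewrite eqxx.
Qed.

Lemma prod_pi (z : algC) : q.-primitive_root z ->
  \prod_(1 <= k < q) (m%:~R - n%:~R * z ^+ k) = p%:R.
Proof.
move=> z_prim; have q0 := prime_gt0 q_prime.
have n0 : (n%:~R : algC) != 0.
  by rewrite intr_eq0; apply: contraNneq n_Fp_neq0 => ->.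
have full : \prod_(0 <= k < q) (m%:~R - n%:~R * z ^+ k) = m%:~R ^+ q - n%:~R ^+ q.
  have /(congr1 (fun P => P.[m%:~R / n%:~R])) := factor_Xn_sub_1 z_prim.
  rewrite /= horner_prod !hornerE /= => E.
  have -> : m%:~R ^+ q - n%:~R ^+ q = n%:~R ^+ q * ((m%:~R / n%:~R) ^+ q - 1) :> algC.
    by rewrite mulrBr mulr1 -exprMn mulrCA divff // mulr1.
  rewrite -E -[X in n%:~R ^+ X](subn0 q) -prodr_const_nat -big_split /=.
  by apply: eq_bigr => i _; rewrite !hornerE mulrBr mulrCA divff // mulr1.
have mn0 : (m%:~R - n%:~R : algC) != 0.
  rewrite -rmorphB intr_eq0; apply/eqP => mn.
  have := prim_order_dvd z_Fp_prim 1.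
  have -> : z_Fp = 1.
    rewrite /z_Fp (_ : m = n) ?divff ?n_Fp_neq0 //.
    by apply/eqP; rewrite -subr_eq0 mn.
  by rewrite expr1 eqxx dvdn1 gtn_eqF ?prime_gt1.
apply: (mulfI mn0).
have -> : p%:R = \sum_(i < q) m%:~R ^+ i * n%:~R ^+ (q - 1 - i) :> algC.
  rewrite pmulrn p_def rmorph_sum; apply: eq_bigr => i _.
  by rewrite rmorphM !rmorphXn.
by rewrite homogeneous_sum -full (big_ltn q0) expr0 mulr1.
Qed.



Definition ev_Fp (x : 'F_p) (h : {poly int}) : 'F_p := (map_poly intr h).[x].

(** Modulo m - n zeta one has p = 0, and zeta = r for an integer r that represents
    z_Fp, because n is invertible modulo p; so h(zeta) = h(r) = 0. *)
Lemma dvd_pi1 z (h : {poly int}) : q.-primitive_root z ->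
  ev_Fp z_Fp h = 0 -> exists R, ev z h = (m%:~R - n%:~R * z) * ev z R.
Proof.
move=> z_prim hz.
pose r : int := (z_Fp : nat).
have rz : r%:~R = z_Fp by rewrite -pmulrn natr_Zp.
have [t Et] : exists t, n * r = m + p%:Z * t.
  have /dvdzP[t Et] : (p %| n * r - m)%Z.
    by rewrite (dvdz_pcharf (pchar_Fp p_prime)) rmorphB rmorphM /= rz mulrC z_FpM subrr.
  by exists t; rewrite [p%:Z * _]mulrC -Et subrKC.
have [h2 Eh2] := poly_divX h r.
have [c Ec] : exists c, h.[r] = p%:Z * c.
  have /dvdzP[c Ec] : (p %| h.[r])%Z.
    by rewrite (dvdz_pcharf (pchar_Fp p_prime)) -horner_map /= rz -/(ev_Fp z_Fp h) hz.
  by exists c; rewrite mulrC.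
have [n' [t' En]] : exists n' t', n * n' = 1 + p%:Z * t'.
  have n0 := n_Fp_neq0.
  have /dvdzP[t' Et'] : (p %| n * ((n%:~R : 'F_p)^-1 : nat)%:Z - 1)%Z.
    rewrite (dvdz_pcharf (pchar_Fp p_prime)) rmorphB rmorphM /= -pmulrn natr_Zp.
    by rewrite divff // subrr.
  by exists ((n%:~R : 'F_p)^-1 : nat)%:Z, t'; rewrite [p%:Z * _]mulrC -Et' subrKC.
pose P : {poly int} := \prod_(2 <= k < q) (m%:P - n%:P * 'X^k).
have EP : p%:R = (m%:~R - n%:~R * z) * ev z P.
  rewrite -(prod_pi z_prim) (big_ltn (ltnW q_gt2)) expr1.
  congr (_ * _); rewrite rmorph_prod; apply: eq_bigr => k _.
  by rewrite rmorphB rmorphM /= !evC evXn.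
exists (c *: P - (n' *: 1 + P * (n' * t)%:P + P * t'%:P * ('X - r%:P)) * h2).
rewrite {1}Eh2 Ec.
have zr : z - r%:~R =
    - (m%:~R - n%:~R * z) * n'%:~R - p%:R * (n' * t)%:~R - p%:R * t'%:~R * (z - r%:~R).
  have E1 : n%:~R * r%:~R = m%:~R + p%:R * t%:~R :> algC.
    by rewrite -rmorphM Et rmorphD rmorphM.
  have E2 : n%:~R * n'%:~R = 1 + p%:R * t'%:~R :> algC.
    by rewrite -rmorphM En rmorphD rmorphM.
  transitivity ((n%:~R * n'%:~R - p%:R * t'%:~R) * (z - r%:~R)).
    by rewrite E2 addrK mul1r.
  transitivity (n'%:~R * (n%:~R * z - n%:~R * r%:~R) - p%:R * t'%:~R * (z - r%:~R)).
    by ring.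
  by rewrite E1 rmorphM /=; ring.
rewrite !evE {1}zr !rmorphM /= -pmulrn EP; ring.
Qed.

Lemma ev_Fp_cyclo x : q.-primitive_root x -> ev_Fp x (cyclo q) = 0.
Proof.
move=> x_prim; rewrite /ev_Fp rmorph_sum horner_sum /=.
rewrite (eq_bigr (fun i : 'I_q => x ^+ i)) => [|i _]; last by rewrite map_polyXn hornerXn.
have x1 : x - 1 != 0.
  rewrite subr_eq0 -[x]expr1 -(prim_order_dvd x_prim) dvdn1.
  by rewrite gtn_eqF ?prime_gt1.
by apply: (mulfI x1); rewrite mulr0 -subrX1 (prim_expr_order x_prim) subrr.
Qed.

Lemma prim_exp (R : idomainType) (x : R) k : q.-primitive_root x -> (0 < k < q)%N ->
  q.-primitive_root (x ^+ k).
Proof.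
move=> x_prim /andP[k0 kq]; rewrite prim_root_exp_coprime //.
by rewrite coprime_sym prime_coprime // gtnNdvd.
Qed.

Definition invmod (l : nat) : nat := (l ^ (q - 2))%N.

Lemma invmodP l : (0 < l < q)%N -> (l * invmod l = 1 %[mod q])%N.
Proof. exact: inv_modq. Qed.

(** At zeta this is a generator of a prime above p. *)
Definition pi_poly (k : nat) : {poly int} := m%:P - n%:P * 'X^k.

(** Apply [dvd_pi1] to the root of unity zeta^(1 / l). *)
Lemma dvd_pi z (h : {poly int}) l : q.-primitive_root z -> (0 < l < q)%N ->
  ev_Fp (z_Fp ^+ l) h = 0 -> exists R, ev z h = ev z (pi_poly (invmod l)) * ev z R.
Proof.
move=> z_prim lq hz.
have zk : q.-primitive_root (z ^+ invmod l).
  rewrite prim_root_exp_coprime // coprime_sym prime_coprime // /invmod Euclid_dvdX //.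
  by case/andP: lq => l0 lq; rewrite gtnNdvd.
have hl : ev_Fp z_Fp (h \Po 'X^l) = 0.
  by rewrite /ev_Fp map_comp_poly map_polyXn horner_comp hornerXn.
have [R ER] := dvd_pi1 zk hl.
exists (R \Po 'X^(invmod l)).
rewrite {1}/pi_poly [ev z (_ - _)]evD evN !evE ev_comp -ER ev_comp -exprM.
have -> : z ^+ (invmod l * l) = z.
  apply/eqP; rewrite -[X in _ == X]expr1 (eq_prim_root_expr z_prim) mulnC.
  by apply/eqP; exact: invmodP.
by [].
Qed.

Lemma invmod_inj l l' : (0 < l < q)%N -> (0 < l' < q)%N ->
  l' * invmod l = 1 %[mod q] -> l' = l.
Proof.
move=> lq lq' E.
have : l' * invmod l * l = 1 * l %[mod q] by rewrite -modnMml E modnMml.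
rewrite mul1n -mulnA [(invmod l * l)%N]mulnC -modnMmr invmodP // modnMmr muln1.
by case/andP: lq lq' => _ lq /andP[_ lq']; rewrite !modn_small.
Qed.

(** The primes are pairwise distinct: after division by one of them the quotient
    still vanishes at the roots attached to the others, as these are not roots
    of the divisor. *)
Lemma dvd_pis z (s : seq nat) (h : {poly int}) : q.-primitive_root z ->
  uniq s -> {in s, forall l, (0 < l < q)%N /\ ev_Fp (z_Fp ^+ l) h = 0} ->
  exists R, ev z h = (\prod_(l <- s) ev z (pi_poly (invmod l))) * ev z R.
Proof.
move=> z_prim; elim: s h => [|l s IH] h /=.
  by move=> _ _; exists h; rewrite big_nil mul1r.
move=> /andP[ls us] hs.
have [lq hl] := hs l (mem_head _ _).
have [h1 E1] := dvd_pi z_prim lq hl.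
have [W EW] : exists W, h - pi_poly (invmod l) * h1 = cyclo q * W.
  by apply: (ev_eq0 q_prime z_prim); rewrite evD evN evM E1 subrr.
have hs1 : {in s, forall l', (0 < l' < q)%N /\ ev_Fp (z_Fp ^+ l') h1 = 0}.
  move=> l' ls'; have [lq' hl'] : (0 < l' < q)%N /\ ev_Fp (z_Fp ^+ l') h = 0.
    by apply: hs; rewrite inE ls' orbT.
  split=> //.
  have := congr1 (ev_Fp (z_Fp ^+ l')) EW.
  rewrite /ev_Fp rmorphB !rmorphM /= hornerD hornerN !hornerM -!/(ev_Fp _ _).
  rewrite hl' ev_Fp_cyclo ?prim_exp ?z_Fp_prim // mul0r sub0r => /eqP.
  rewrite oppr_eq0 mulf_eq0 => /orP[|/eqP //].
  rewrite /ev_Fp rmorphB rmorphM /= !map_polyC map_polyXn !hornerE /= subr_eq0 -z_FpM mulrC.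
  rewrite (inj_eq (mulfI n_Fp_neq0)) -exprM -{1}[z_Fp]expr1.
  rewrite (eq_prim_root_expr z_Fp_prim) eq_sym.
  move=> /eqP /(invmod_inj lq lq') ll.
  by rewrite -ll ls' in ls.
have [R ER] := IH h1 us hs1.
by exists R; rewrite E1 ER big_cons mulrA.
Qed.

End Prime.

(** * Gauss and Jacobi sums *)

Section AddChar.

Variable p : nat.
Hypothesis p_prime : prime p.
Variable xi : algC.
Hypothesis xi_prim : p.-primitive_root xi.

Definition addchar (t : 'F_p) : algC := xi ^+ (t : nat).

Lemma addcharE (k : nat) : addchar k%:R = xi ^+ k.
Proof. by rewrite /addchar val_Fp_nat // prim_expr_mod. Qed.

Lemma addcharD s t : addchar (s + t) = addchar s * addchar t.
Proof. by rewrite -[s]natr_Zp -[t]natr_Zp -natrD !addcharE exprD. Qed.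

Lemma addcharM (k : nat) t : addchar (k%:R * t) = addchar t ^+ k.
Proof. by rewrite -[t]natr_Zp -natrM !addcharE mulnC exprM. Qed.

Lemma addchar0 : addchar 0 = 1.
Proof. by rewrite -[0]/(0%:R) addcharE. Qed.

Lemma addchar_conj t : (addchar t)^* = addchar (- t).
Proof.
have p0 := prime_gt0 p_prime.
have E : addchar t ^+ p = 1 by rewrite -addcharM pchar_Fp_0 // mul0r addchar0.
rewrite (conjC_root1 p0 E) -[LHS]mulr1 -addchar0 -(subrr t) addcharD mulrA.
by rewrite -exprSr prednK // E mul1r.
Qed.

Lemma sum_addchar (c : 'F_p) :
  \sum_t addchar (t * c) = if c == 0 then p%:R else 0.
Proof.
case: eqVneq => [->|c0].
  rewrite (eq_bigr (fun=> 1)) => [|t _]; last by rewrite mulr0 addchar0.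
  by rewrite sumr_const card_Fp.
have x1 : addchar c - 1 != 0.
  rewrite subr_eq0 /addchar -(prim_order_dvd xi_prim) gtnNdvd //.
    by rewrite lt0n; apply: contraNneq c0 => c0; apply/eqP/val_inj.
  by have := ltn_ord c; rewrite [X in (_ < X)%N]Fp_cast.
apply: (mulfI x1); rewrite mulr0 mulrBl mul1r mulr_sumr.
rewrite [X in X - _](reindex_inj (addIr (-1))) /=.
rewrite -sumrB big1 // => t _.
by rewrite -addcharD // mulrBl mul1r addrCA subrr addr0 subrr.
Qed.

End AddChar.

Section GaussSums.

Variables (p q : nat).
Hypothesis p_prime : prime p.
Hypothesis q_gt2 : (2 < q)%N.
Variable xi : algC.
Hypothesis xi_prim : p.-primitive_root xi.
Local Notation psi := (addchar xi).

Variable chi : 'F_p -> algC.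
Hypothesis chi0 : chi 0 = 0.
Hypothesis chiM : {morph chi : s t / s * t}.
Hypothesis chiX : forall t, t != 0 -> chi t ^+ q = 1.
Hypothesis chiN1 : chi (- 1) = 1.
Hypothesis chi_nontrivial :
  exists2 c, c != 0 & forall i, (0 < i < q)%N -> chi c ^+ i != 1.

Definition gauss (i : nat) : algC := \sum_t chi t ^+ i * psi t.
Definition jacobi (i : nat) : algC := \sum_t chi t * chi (1 - t) ^+ i.

Lemma sum_chi i : (0 < i < q)%N -> \sum_t chi t ^+ i = 0.
Proof.
move=> iq; have [c c0 /(_ i iq) ci] := chi_nontrivial.
have c1 : chi c ^+ i - 1 != 0 by rewrite subr_eq0.
apply: (mulfI c1); rewrite mulr0 mulrBl mul1r mulr_sumr.
rewrite [X in _ - X](reindex_inj (mulfI c0)) -sumrB big1 // => t _.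
by rewrite chiM exprMn subrr.
Qed.

(** Collect the pairs (s, t) by u = s + t; the terms with u = 0 cancel. *)
Lemma gauss_jacobi i : (0 < i)%N -> (i.+1 < q)%N ->
  gauss 1 * gauss i = jacobi i * gauss i.+1.
Proof.
move=> i0 iq.
have -> : gauss 1 * gauss i = \sum_u psi u * \sum_s chi s * chi (u - s) ^+ i.
  rewrite /gauss mulr_suml.
  under eq_bigr => s _ do
    rewrite mulr_sumr (reindex_inj (addIr (- s))) /=.
  rewrite exchange_big; apply: eq_bigr => u _ /=.
  rewrite mulr_sumr; apply: eq_bigr => s _.
  have -> : psi u = psi (u - s) * psi s by rewrite -addcharD ?subrK.
  by rewrite expr1; ring.
rewrite /gauss mulr_sumr; apply: eq_bigr => u _.
rewrite mulrA [RHS]mulrC; congr (_ * _).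
have [-> | kummer_coef0] := eqVneq u 0.
  rewrite chi0 expr0n mulr0.
  rewrite (eq_bigr (fun s => chi s ^+ i.+1)) => [|s _]; first by rewrite sum_chi.
  by rewrite sub0r -mulN1r chiM chiN1 mul1r exprS.
rewrite (reindex_inj (mulfI kummer_coef0)) /jacobi mulr_suml; apply: eq_bigr => s _.
have -> : u - u * s = u * (1 - s) by rewrite mulrBr mulr1.
by rewrite !chiM exprMn exprS; ring.
Qed.

(** Here the two characters are inverse to each other, and only the terms with
    s + t = 0 survive. *)
Lemma gauss_last : gauss 1 * gauss q.-1 = p%:R.
Proof.
have q1 : (0 < q.-1)%N by lia.
transitivity (\sum_r chi r * \sum_(t | t != 0) psi (t * (r + 1))).
  transitivity (\sum_(t | t != 0) \sum_r chi r * psi (t * (r + 1))).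
    rewrite /gauss mulr_sumr (bigD1 0) //= chi0 expr0n gtn_eqF // mul0r mulr0 add0r.
    apply: eq_bigr => t t0; rewrite mulr_suml (reindex_inj (mulfI t0)) /=.
    apply: eq_bigr => r _; rewrite mulrDr mulr1 addcharD // expr1 chiM.
    transitivity (chi t ^+ q * (chi r * (psi (t * r) * psi t))); last by rewrite chiX // mul1r.
    by rewrite -(prednK (ltnW (ltnW q_gt2))) exprS /=; ring.
  by rewrite exchange_big; apply: eq_bigr => r _; rewrite mulr_sumr.
transitivity (\sum_r (chi r * \sum_t psi (t * (r + 1)) - chi r)).
  apply: eq_bigr => r _; rewrite [in RHS](bigD1 0) //= mul0r addchar0 //.
  by rewrite mulrDr mulr1 addrAC subrr add0r.
rewrite sumrB; have -> : \sum_r chi r = 0.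
  transitivity (\sum_r chi r ^+ 1); first by apply: eq_bigr => r _; rewrite expr1.
  by rewrite sum_chi //; lia.
rewrite subr0 (bigD1 (- 1)) //= sum_addchar // addNr eqxx chiN1 mul1r big1 ?addr0 // => r r1.
by rewrite sum_addchar // addr_eq0 (negbTE r1) mulr0.
Qed.

Lemma gauss_pow : gauss 1 ^+ q = p%:R * \prod_(1 <= i < q.-1) jacobi i.
Proof.
have pow k : (0 < k < q)%N -> gauss 1 ^+ k = (\prod_(1 <= i < k) jacobi i) * gauss k.
  elim: k => [//|[_ _|k IH /andP[_ kq]]]; first by rewrite big_geq // mul1r.
  rewrite exprS IH ?(ltnW kq) // mulrCA gauss_jacobi //.
  by rewrite [in RHS]big_nat_recr //= mulrA.
rewrite -{1}(prednK (ltnW (ltnW q_gt2))) exprS pow; last by lia.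
by rewrite mulrCA gauss_last mulrC.
Qed.

Lemma gauss_conj : gauss 1 * (gauss 1)^* = p%:R.
Proof.
rewrite -gauss_last; congr (_ * _); rewrite /gauss rmorph_sum (reindex_inj oppr_inj) /=.
apply: eq_bigr => t _; rewrite rmorphM /= addchar_conj // opprK expr1.
congr (_ * _); rewrite -mulN1r chiM chiN1 mul1r.
have [->|t0] := eqVneq t 0; first by rewrite chi0 rmorph0 expr0n gtn_eqF //; lia.
by rewrite (conjC_root1 _ (chiX t0)) //; lia.
Qed.

End GaussSums.

(** * The q-th power of a Gauss sum modulo lambda^(q + 1) *)

Definition cong (e x y : algC) := exists2 c, c \in Aint & x = y + e * c.

Lemma cong_refl e x : cong e x x.
Proof. by exists 0; rewrite ?rpred0 // mulr0 addr0. Qed.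

Lemma cong_trans e x y w : cong e x y -> cong e y w -> cong e x w.
Proof.
move=> [a Aa ->] [b Ab ->]; exists (a + b); first by rewrite rpredD.
by rewrite mulrDr -addrA [e * b + _]addrC.
Qed.

Lemma congD e x y x' y' : cong e x y -> cong e x' y' -> cong e (x + x') (y + y').
Proof.
move=> [a Aa ->] [b Ab ->]; exists (a + b); first by rewrite rpredD.
by rewrite mulrDr addrACA.
Qed.

Lemma congN e x y : cong e x y -> cong e (- x) (- y).
Proof. by move=> [a Aa ->]; exists (- a); rewrite ?rpredN // mulrN opprD. Qed.

Lemma congM e w x y : w \in Aint -> cong e x y -> cong e (w * x) (w * y).
Proof.
by move=> Aw [a Aa ->]; exists (w * a); rewrite ?rpredM // mulrDr mulrCA.
Qed.

Lemma cong_sum e (I : finType) (P : pred I) (F G : I -> algC) :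
  (forall i, P i -> cong e (F i) (G i)) ->
  cong e (\sum_(i | P i) F i) (\sum_(i | P i) G i).
Proof.
move=> FG; apply: (big_rec2 (cong e)) => [|i x y Pi xy]; first exact: cong_refl.
by apply: congD => //; apply: FG.
Qed.

Lemma cong_dvd d e x y : d \in Aint -> cong (e * d) x y -> cong e x y.
Proof. by move=> Ad [a Aa ->]; exists (d * a); rewrite ?rpredM // mulrA. Qed.

Lemma congX e x y k : e \in Aint -> y \in Aint -> cong e x y -> cong e (x ^+ k) (y ^+ k).
Proof.
move=> Ae Ay [a Aa ->]; elim: k => [|k [b Ab IH]]; first exact: cong_refl.
rewrite !exprS IH; exists (a * y ^+ k + y * b + e * (a * b)); last by ring.
by rewrite !(rpredD, rpredM) ?rpredX.
Qed.

Lemma cong_sym e x y : cong e x y -> cong e y x.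
Proof. by move=> [a Aa ->]; exists (- a); rewrite ?rpredN // mulrN addrK. Qed.

Lemma cong_mul e x y x' y' : x \in Aint -> y' \in Aint ->
  cong e x y -> cong e x' y' -> cong e (x * x') (y * y').
Proof.
move=> Ax Ay' xy xy'; apply: cong_trans (congM Ax xy') _.
by rewrite ![_ * y']mulrC; apply: congM.
Qed.

Lemma cong_prod e (I : Type) (r : seq I) (F G : I -> algC) :
  (forall i, F i \in Aint) -> (forall i, G i \in Aint) ->
  (forall i, cong e (F i) (G i)) ->
  cong e (\prod_(i <- r) F i) (\prod_(i <- r) G i).
Proof.
move=> AF AG FG; elim: r => [|i r IH]; first by rewrite !big_nil; exact: cong_refl.
by rewrite !big_cons; apply: cong_mul => //; apply: rpred_prod => j _.
Qed.

Section Congruence.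

Variable q : nat.
Hypothesis q_prime : prime q.
Hypothesis q_gt2 : (2 < q)%N.

Lemma cong_exprqD (x y : algC) : x \in Aint -> y \in Aint ->
  cong q%:R ((x + y) ^+ q) (x ^+ q + y ^+ q).
Proof.
move=> Ax Ay; have q0 := prime_gt0 q_prime.
exists (\sum_(1 <= i < q) (x ^+ (q - i) * y ^+ i) *+ ('C(q, i) %/ q)).
  by apply: rpred_sum => i _; rewrite rpredMn // rpredM ?rpredX.
rewrite exprDn -(big_mkord xpredT (fun i => x ^+ (q - i) * y ^+ i *+ 'C(q, i))).
rewrite big_nat_recr //= big_ltn // subnn subn0 bin0 binn !expr0 !mulr1n mulr1 mul1r.
rewrite addrAC; congr (_ + _); rewrite mulr_sumr; apply: eq_big_nat => i /andP[i0 iq].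
by rewrite mulr_natl -mulrnA divnK // prime_dvd_bin // i0.
Qed.

Lemma cong_exprq_sum (I : finType) (P : pred I) (F : I -> algC) :
  (forall i, F i \in Aint) ->
  cong q%:R ((\sum_(i | P i) F i) ^+ q) (\sum_(i | P i) F i ^+ q).
Proof.
move=> AF; suff [] : cong q%:R ((\sum_(i | P i) F i) ^+ q) (\sum_(i | P i) F i ^+ q)
   /\ (\sum_(i | P i) F i) \in Aint by [].
apply: (big_rec2 (fun x y => cong q%:R (x ^+ q) y /\ x \in Aint)) => [|i x y _ [xy Ax]].
  by rewrite expr0n gtn_eqF ?prime_gt0 // rpred0; split=> //; exact: cong_refl.
split; last by rewrite rpredD.
by apply: cong_trans (cong_exprqD (AF i) Ax) _; apply: congD => //; exact: cong_refl.
Qed.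

Variable z : algC.
Hypothesis z_prim : q.-primitive_root z.
Local Notation lam := (1 - z).

Lemma Aint_lam : lam \in Aint.
Proof. by rewrite rpredB ?rpred1 ?(Aint_z z_prim). Qed.

(** From q = - lambda^(q - 1) modulo q lambda, the power of lambda that divides q
    grows by induction. *)
Lemma q_lam_pow : exists2 w, w \in Aint & q%:R = lam ^+ q.-1 * w.
Proof.
have [e2 le] := lam_predq q_prime q_gt2 z_prim.
have Eq : q%:R = - lam ^+ q.-1 - lam * ev z e2 * q%:R.
  rewrite le; ring.
suff H k : (k <= q.-1)%N -> exists2 w, w \in Aint & q%:R = lam ^+ k * w by exact: H.
elim: k => [_|k IH kq]; first by exists q%:R; rewrite ?rpred_nat // mul1r.
have [w Aw Ew] := IH (ltnW kq).
exists (- lam ^+ (q.-1 - k.+1) - ev z e2 * w).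
  by rewrite rpredB ?rpredN ?rpredX ?Aint_lam // rpredM // (Aint_ev z_prim).
rewrite mulrBr mulrN -exprD subnKC // {1}Eq {1}Ew exprS; ring.
Qed.

(** In other words q = - lambda^(q - 1) modulo lambda^q. *)
Lemma qlam_cong : cong (lam ^+ q.+1) (q%:R * lam) (- lam ^+ q).
Proof.
have [e2 le] := lam_predq q_prime q_gt2 z_prim.
have [w Aw Ew] := q_lam_pow.
exists (- ev z e2 * w); first by rewrite rpredM ?rpredN ?(Aint_ev z_prim).
have E1 : lam ^+ q.+1 = lam ^+ 2 * lam ^+ q.-1.
  by rewrite -exprD; congr (_ ^+ _); lia.
have E2 : lam ^+ q = lam * lam ^+ q.-1 by rewrite -exprS prednK ?prime_gt0.
rewrite E2 E1.
have -> : lam ^+ 2 * lam ^+ q.-1 * (- ev z e2 * w) = - lam ^+ 2 * ev z e2 * q%:R.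
  by rewrite Ew; ring.
rewrite le; ring.
Qed.

(** In the binomial expansion the terms 2 <= i < q are divisible by q lambda^2,
    hence by lambda^(q + 1), and the term i = 1 is q lambda V = - lambda^q V by [qlam_cong]. *)
Lemma one_lam_pow V : V \in Aint ->
  cong (lam ^+ q.+1) ((1 + lam * V) ^+ q) (1 + lam ^+ q * (V ^+ q - V)).
Proof.
move=> AV; have q0 := prime_gt0 q_prime.
have [w Aw Ew] := q_lam_pow.
have mid : cong (lam ^+ q.+1) (\sum_(2 <= i < q) (lam * V) ^+ i *+ 'C(q, i)) 0.
  exists (\sum_(2 <= i < q) (w * (lam ^+ (i - 2) * V ^+ i)) *+ ('C(q, i) %/ q)).
    apply: rpred_sum => i _; rewrite rpredMn // rpredM // rpredM ?rpredX //.
    exact: Aint_lam.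
  rewrite add0r mulr_sumr; apply: eq_big_nat => i /andP[i2 iq].
  have /dvdnP[c Ec] : (q %| 'C(q, i))%N by rewrite prime_dvd_bin // iq (leq_trans _ i2).
  rewrite Ec mulnK // mulrnA -[_ *+ q]mulr_natl Ew exprMn.
  rewrite -[in lam ^+ i](subnKC i2) exprD mulrnAr mulrnAr; congr (_ *+ _).
  have -> : lam ^+ q.+1 = lam ^+ 2 * lam ^+ q.-1.
    by rewrite -exprD; congr (_ ^+ _); lia.
  ring.
have -> : (1 + lam * V) ^+ q = \sum_(2 <= i < q) (lam * V) ^+ i *+ 'C(q, i) +
    (1 + lam ^+ q * V ^+ q + V * (q%:R * lam)).
  rewrite exprDn -(big_mkord xpredT (fun i => 1 ^+ (q - i) * (lam * V) ^+ i *+ 'C(q, i))).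
  rewrite big_nat_recr //= big_ltn // big_ltn; last exact: ltnW.
  rewrite bin0 bin1 binn expr0 expr1 !expr1n !mul1r !mulr1n exprMn -[_ *+ q]mulr_natl.
  rewrite (eq_bigr (fun i => (lam * V) ^+ i *+ 'C(q, i))) => [|i _];
    last by rewrite expr1n mul1r.
  ring.
have -> : 1 + lam ^+ q * (V ^+ q - V) = 0 + (1 + lam ^+ q * V ^+ q + V * (- lam ^+ q)) by ring.
apply: congD => //; apply: congD; first exact: cong_refl.
by apply: congM => //; exact: qlam_cong.
Qed.

Lemma zpow_lin i : cong lam (z ^+ i) 1.
Proof.
exists (- \sum_(j < i) z ^+ j).
  by rewrite rpredN; apply: rpred_sum => j _; rewrite rpredX ?(Aint_z z_prim).
by apply/eqP; rewrite mulrN -mulNr opprB -subrX1 subrKC.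
Qed.

Lemma cong_int (a b : int) : (q %| a - b)%Z -> cong q%:R a%:~R b%:~R.
Proof.
move=> /dvdzP[c E]; exists c%:~R; first exact: Aint_int.
by rewrite -[a](subrK b) E rmorphD rmorphM /= mulrC addrC.
Qed.

Variable p : nat.
Hypothesis p_prime : prime p.
Hypothesis p_neq_q : p <> q.
Variable xi : algC.
Hypothesis xi_prim : p.-primitive_root xi.
Local Notation psi := (addchar xi).

Variable dlog : 'F_p -> nat.
Hypothesis dlogM : forall s t, s != 0 -> t != 0 ->
  dlog (s * t) = dlog s + dlog t %[mod q].

Definition chi (t : 'F_p) : algC := if t == 0 then 0 else z ^+ dlog t.

Lemma Aint_psi (t : 'F_p) : psi t \in Aint.
Proof. by rewrite rpredX ?(Aint_prim_root xi_prim). Qed.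

Lemma sum_psi_neq0 : \sum_(t : 'F_p | t != 0) psi t = -1.
Proof.
have := sum_addchar p_prime xi_prim 1; rewrite oner_eq0.
rewrite (eq_bigr (fun t : 'F_p => psi t)) => [|t _]; last by rewrite mulr1.
by rewrite (bigD1 0) //= addchar0 // => /eqP; rewrite addrC addr_eq0 => /eqP.
Qed.

(** One has - G = 1 + lambda V, where V = sum_t dlog(t) psi(t) modulo lambda.  By the
    Frobenius congruence V^q = sum_t dlog(t) psi(q t), and the substitution
    t -> t / q turns this into V + dlog(q).  Conclude by [one_lam_pow]. *)
Lemma gauss_congr :
  cong (lam ^+ q.+1) (- gauss xi chi 1 ^+ q) (1 + (dlog q%:R)%:R * lam ^+ q).
Proof.
have q0 := prime_gt0 q_prime.
have Alam := Aint_lam.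
pose v (t : 'F_p) := \sum_(j < dlog t) z ^+ j.
have Av t : v t \in Aint.
  by apply: rpred_sum => j _; rewrite rpredX ?(Aint_z z_prim).
pose V := \sum_(t : 'F_p | t != 0) v t * psi t.
pose U := \sum_(t : 'F_p | t != 0) (dlog t)%:R * psi t.
have AV : V \in Aint by apply: rpred_sum => t _; rewrite rpredM ?Av ?Aint_psi.
have AU : U \in Aint by apply: rpred_sum => t _; rewrite rpredM ?rpred_nat ?Aint_psi.
have gV : - gauss xi chi 1 = 1 + lam * V.
  rewrite /gauss (bigD1 0) //= /chi eqxx expr1 mul0r add0r.
  rewrite (eq_bigr (fun t => psi t - lam * (v t * psi t))) => [|t t0].
    by rewrite sumrB sum_psi_neq0 -mulr_sumr -/V; ring.
  have Ez : z ^+ dlog t = 1 - lam * v t.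
    by rewrite -[lam]opprB mulNr opprK -subrX1 subrKC.
  by rewrite (negbTE t0) expr1 Ez; ring.
have VU : cong lam V U.
  apply: cong_sum => t t0; rewrite ![_ * psi t]mulrC; apply: congM; first exact: Aint_psi.
  have -> : (dlog t)%:R = \sum_(j < dlog t) 1 :> algC by rewrite sumr_const card_ord.
  by apply: cong_sum => j _; exact: zpow_lin.
have lam_q x y : cong q%:R x y -> cong lam x y.
  have [w Aw ->] := q_lam_pow; rewrite -(prednK (_ : 0 < q.-1)%N); last by lia.
  rewrite exprS -mulrA; apply: cong_dvd.
  by rewrite rpredM ?rpredX.
have Uq : cong lam (U ^+ q) (U + (dlog q%:R)%:R).
  apply: cong_trans (lam_q _ _ (cong_exprq_sum _ _)) _.
    by move=> t; rewrite rpredM ?rpred_nat ?Aint_psi.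
  have q00 := prime_Fp_neq0 p_prime q_prime p_neq_q.
  have re F : \sum_(t : 'F_p | t != 0) F (q%:R * t) = \sum_(t : 'F_p | t != 0) F t :> algC.
    rewrite [RHS](reindex_inj (mulfI q00)); apply: eq_bigl => t.
    by rewrite mulf_eq0 (negbTE q00).
  have -> : U + (dlog q%:R)%:R =
      \sum_(t : 'F_p | t != 0) ((dlog (q%:R * t))%:R - (dlog q%:R)%:R) * psi (q%:R * t).
    rewrite (re (fun t => ((dlog t)%:R - (dlog q%:R)%:R) * psi t)).
    under eq_bigr do rewrite mulrBl.
    by rewrite sumrB -mulr_sumr sum_psi_neq0 mulrN1 opprK.
  apply: cong_sum => t t0; rewrite exprMn -addcharM // ![_ * psi _]mulrC.
  apply: congM; first exact: Aint_psi.
  apply: lam_q.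
  have -> : (dlog t)%:R ^+ q = ((dlog t)%:Z ^+ q)%:~R :> algC by rewrite rmorphXn.
  have -> : (dlog (q%:R * t))%:R - (dlog q%:R)%:R =
      ((dlog (q%:R * t))%:Z - (dlog q%:R)%:Z)%:~R :> algC.
    by rewrite rmorphB.
  apply: cong_int.
  have -> : (dlog t)%:Z ^+ q - ((dlog (q%:R * t))%:Z - (dlog q%:R)%:Z) =
     ((dlog t)%:Z ^+ q - (dlog t)%:Z) - ((dlog (q%:R * t))%:Z - (dlog q%:R + dlog t)%N%:Z).
    by rewrite PoszD; ring.
  rewrite rpredB ?dvdz_fermat // -eqz_mod_dvd !modz_nat eqz_nat.
  by apply/eqP; apply: dlogM.
have VqU : cong lam (V ^+ q - V) (dlog q%:R)%:R.
  have -> : (dlog q%:R)%:R = (U + (dlog q%:R)%:R) - U by rewrite addrAC subrr add0r.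
  apply: congD; last exact: congN.
  by apply: cong_trans Uq; apply: congX.
have -> : - gauss xi chi 1 ^+ q = (1 + lam * V) ^+ q.
  by rewrite -gV exprNn sign_q // mulN1r.
apply: cong_trans (one_lam_pow AV) _; apply: congD; first exact: cong_refl.
have [c Ac ->] := VqU; exists c => //.
by rewrite exprSr; ring.
Qed.

End Congruence.

(** * Stickelberger factorization of the q-th power of the Gauss sum *)

Lemma expr1_neq0 (R : nzRingType) (x : R) k : (0 < k)%N -> x ^+ k = 1 -> x != 0.
Proof.
by move=> k0 xk; apply: contra_eq_neq xk => ->; rewrite expr0n gtn_eqF // eq_sym oner_eq0.
Qed.

Section Fp.

Variable p : nat.
Hypothesis p_prime : prime p.

Lemma Fp_fermat (t : 'F_p) : t != 0 -> t ^+ p.-1 = 1.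
Proof.
move=> t0; apply: (mulfI t0); rewrite mulr1 -exprS prednK ?prime_gt0 //.
by have := expf_card t; rewrite card_Fp.
Qed.

Lemma Fp_generator : exists x : 'F_p, p.-1.-primitive_root x.
Proof.
have p1 : (0 < p.-1)%N by have := prime_gt1 p_prime; case: (p) => [|[]].
have /hasP[x _ x_prim] : has p.-1.-primitive_root (enum (predC1 (0 : 'F_p))).
  apply: has_prim_root => //; last 2 first.
  - exact: enum_uniq.
  - by rewrite -cardE cardC1 card_Fp.
  by apply/allP => t; rewrite mem_enum /= => t0; rewrite unity_rootE Fp_fermat.
by exists x.
Qed.

(** Multiply the summation variable by a generator of the units. *)
Lemma sum_expr_Fp e : (e < p.-1)%N -> \sum_(t : 'F_p) t ^+ e = 0.
Proof.
case: e => [|e] ep.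
  rewrite (eq_bigr (fun=> 1)) => [|t _]; last by rewrite expr0.
  by rewrite sumr_const card_Fp // pchar_Fp_0.
have [x x_prim] := Fp_generator.
have x0 : x != 0 by apply: expr1_neq0 (prim_expr_order x_prim); exact: leq_trans ep.
have x1 : x ^+ e.+1 - 1 != 0 by rewrite subr_eq0 -(prim_order_dvd x_prim) gtnNdvd.
apply: (mulfI x1); rewrite mulr0 mulrBl mul1r mulr_sumr.
rewrite [X in _ - X](reindex_inj (mulfI x0)) -sumrB big1 // => t _.
by rewrite exprMn subrr.
Qed.

Lemma sum_poly_Fp (h : {poly 'F_p}) : (size h <= p.-1)%N -> \sum_t h.[t] = 0.
Proof.
move=> sh; under eq_bigr do rewrite horner_coef.
rewrite exchange_big big1 // => i _; rewrite -mulr_sumr sum_expr_Fp ?mulr0 //.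
exact: leq_trans (ltn_ord i) sh.
Qed.

End Fp.

Section Stickelberger.

Variable q : nat.
Hypothesis q_prime : prime q.
Hypothesis q_gt2 : (2 < q)%N.
Variables (m n : int) (p : nat).
Hypothesis p_def : p%:Z = \sum_(i < q) m ^+ i * n ^+ (q - 1 - i).
Hypothesis p_prime : prime p.
Hypothesis p_neq_q : p <> q.
Local Notation z_Fp := (z_Fp m n p).
Let z_Fp_prim : q.-primitive_root z_Fp := z_Fp_prim q_prime q_gt2 p_def p_prime p_neq_q.

Let f := (p.-1 %/ q)%N.
Let w : 'F_p := z_Fp^-1.

Lemma z_Fp_neq0 : z_Fp != 0.
Proof.
by apply: expr1_neq0 (prim_expr_order z_Fp_prim); exact: prime_gt0.
Qed.

Lemma f_mul_q : (f * q = p.-1)%N.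
Proof. by rewrite divnK // (prim_order_dvd z_Fp_prim) Fp_fermat ?z_Fp_neq0. Qed.

Lemma f_gt0 : (0 < f)%N.
Proof. by have := f_mul_q; have := prime_gt1 p_prime; case: (f) => //; lia. Qed.

Lemma w_prim : q.-primitive_root w.
Proof.
have -> : w = z_Fp ^+ q.-1.
  apply: (mulfI z_Fp_neq0); rewrite divff ?z_Fp_neq0 // -exprS prednK ?prime_gt0 //.
  by rewrite (prim_expr_order z_Fp_prim).
by apply: prim_exp => //; lia.
Qed.

(** The discrete logarithm of t^((p - 1) / q) in base 1 / z.  The inverse of z is
    taken so that the prime attached to l has multiplicity l, and not q - l, in
    the factorization of the Gauss sum. *)
Definition dlog (t : 'F_p) : nat :=
  if [pick i : 'I_q | t ^+ f == w ^+ i] is Some i then i else 0%N.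

Lemma dlogP t : t != 0 -> t ^+ f = w ^+ dlog t /\ (dlog t < q)%N.
Proof.
move=> t0; rewrite /dlog; case: pickP => [i /eqP -> //|no].
have tq : (t ^+ f) ^+ q = 1 by rewrite -exprM f_mul_q Fp_fermat.
by have [i E] := prim_rootP w_prim tq; have := no i; rewrite -E eqxx.
Qed.

Lemma dlogM s t : s != 0 -> t != 0 -> dlog (s * t) = dlog s + dlog t %[mod q].
Proof.
move=> s0 t0; apply/eqP; rewrite -(eq_prim_root_expr w_prim) exprD.
have st0 : s * t != 0 by rewrite mulf_neq0.
by rewrite -!(proj1 (dlogP _)) // exprMn.
Qed.

Variable z : algC.
Hypothesis z_prim : q.-primitive_root z.
Local Notation chi := (chi z dlog).

Lemma chi_0 : chi 0 = 0. Proof. by rewrite /chi eqxx. Qed.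

Lemma chi_M : {morph chi : s t / s * t}.
Proof.
move=> s t; rewrite /chi mulf_eq0.
have [->|s0] := eqVneq s 0; first by rewrite /= mul0r.
have [->|t0] := eqVneq t 0; first by rewrite /= mulr0.
by apply/eqP; rewrite /= -exprD (eq_prim_root_expr z_prim) dlogM.
Qed.

Lemma chi_X t : t != 0 -> chi t ^+ q = 1.
Proof.
by move=> t0; rewrite /chi (negbTE t0) exprAC (prim_expr_order z_prim) expr1n.
Qed.

Lemma chi_N1 : chi (- 1) = 1.
Proof.
have N0 : (- 1 : 'F_p) != 0 by rewrite oppr_eq0 oner_eq0.
have c2 : chi (- 1) ^+ 2 = 1.
  have c10 : chi 1 != 0.
    by apply: expr1_neq0 (chi_X (oner_neq0 _)); exact: prime_gt0.
  rewrite expr2 -chi_M mulrNN mulr1; apply: (mulfI c10).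
  by rewrite -chi_M !mulr1.
have := chi_X N0.
have -> : q = (q./2 * 2).+1.
  by rewrite muln2 -[LHS]odd_double_half odd_q.
by rewrite exprS mulnC exprM c2 expr1n mulr1.
Qed.

Lemma chi_nontrivial :
  exists2 c, c != 0 & forall i, (0 < i < q)%N -> chi c ^+ i != 1.
Proof.
have [x x_prim] := Fp_generator p_prime.
have p1 : (0 < p.-1)%N by rewrite -f_mul_q muln_gt0 f_gt0 prime_gt0.
have x0 : x != 0 by apply: expr1_neq0 (prim_expr_order x_prim).
exists x => // i /andP[i0 iq].
have [Ex _] := dlogP x0.
have xf : q.-primitive_root (x ^+ f).
  by apply: dvdn_prim_root => //; rewrite -f_mul_q dvdn_mull.
rewrite /chi (negbTE x0) -exprM -(prim_order_dvd z_prim) (prim_order_dvd w_prim) exprM -Ex.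
by rewrite -(prim_order_dvd xf) gtnNdvd.
Qed.

Definition jacobi_poly (i : nat) : {poly int} :=
  \sum_(t : 'F_p | (t != 0) && (t != 1)) 'X^(dlog t + i * dlog (1 - t)).

Lemma ev_jacobi i : (0 < i)%N -> ev z (jacobi_poly i) = jacobi chi i.
Proof.
move=> i0; rewrite /jacobi (bigID (fun t : 'F_p => (t != 0) && (t != 1))) /=.
rewrite [X in _ = _ + X]big1 ?addr0 => [|t].
  rewrite rmorph_sum; apply: eq_bigr => t /andP[t0 t1] /=.
  rewrite evXn exprD mulnC exprM /chi (negbTE t0) ifN //.
  by rewrite subr_eq0 eq_sym.
rewrite negb_and !negbK => /orP[]/eqP->; first by rewrite chi_0 mul0r.
by rewrite subrr chi_0 expr0n gtn_eqF // mulr0.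
Qed.

(** At z^l the character t -> X^(dlog t) becomes t -> t^(f (q - l)), so the value is
    the sum over F_p of a polynomial of degree f (q - l + B), where B is the
    residue of (q - l) i modulo q.  This is less than p - 1 when B < l. *)
Lemma jacobi_poly_root l i : (0 < l < q)%N -> (0 < i < q)%N ->
  ((q - l) * i %% q < l)%N -> ev_Fp (z_Fp ^+ l) (jacobi_poly i) = 0.
Proof.
move=> lq iq; set B := ((q - l) * i %% q)%N => Bl.
have q0 := prime_gt0 q_prime.
have B0 : (0 < B)%N.
  rewrite lt0n -/(dvdn q _) Euclid_dvdM // negb_or.
  by case/andP: lq iq => l0 lq /andP[i0 iq]; rewrite !gtnNdvd ?subn_gt0 //; lia.
have zl : z_Fp ^+ l = w ^+ (q - l).
  have zq : z_Fp ^+ (q - l) != 0 by rewrite expf_neq0 ?z_Fp_neq0.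
  apply: (mulIf zq); rewrite -exprD subnKC; last by case/andP: lq => _ /ltnW.
  by rewrite (prim_expr_order z_Fp_prim) /w exprVn mulVf.
have term t : t != 0 -> (z_Fp ^+ l) ^+ dlog t = (t ^+ f) ^+ (q - l).
  by move=> t0; rewrite zl exprAC (proj1 (dlogP t0)).
rewrite /ev_Fp rmorph_sum horner_sum /=.
(* The terms t = 0 and t = 1 may be added: H vanishes there. *)
pose H : {poly 'F_p} := 'X^(f * (q - l)) * (1 - 'X) ^+ (f * B).
have A0 : (0 < f * (q - l))%N by rewrite muln_gt0 f_gt0 subn_gt0; case/andP: lq.
have B1 : (0 < f * B)%N by rewrite muln_gt0 f_gt0.
transitivity (\sum_t H.[t]).
  rewrite [RHS](bigID (fun t : 'F_p => (t != 0) && (t != 1))) /=.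
  rewrite [X in _ = _ + X]big1 ?addr0 => [|t].
    apply: eq_bigr => t /andP[t0 t1].
    have t10 : 1 - t != 0 by rewrite subr_eq0 eq_sym.
    rewrite map_polyXn hornerXn exprD mulnC exprM [X in X * _]term // [(_ ^+ l) ^+ _]term //.
    rewrite /H !hornerE /= !exprM; congr (_ * _).
    rewrite -[X in X = _]exprM /B expr_mod //.
    by rewrite -exprM f_mul_q Fp_fermat.
  rewrite /H !hornerE negb_and !negbK => /orP[]/eqP->.
    by rewrite expr0n gtn_eqF // mul0r.
  by rewrite subrr [X in _ * X]expr0n [_ == 0%N]gtn_eqF // mulr0.
apply: sum_poly_Fp => //.
rewrite /H; apply: leq_trans (size_polyMleq _ _) _; rewrite size_polyXn /=.
have s1 : (size ((1 - 'X : {poly 'F_p}) ^+ (f * B)) <= (f * B).+1)%N.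
  apply: leq_trans (size_poly_exp_leq _ _) _.
  by rewrite -opprB size_polyN size_XsubC mul1n.
have E : (f * (q - l) + f * B < p.-1)%N.
  rewrite -f_mul_q -mulnDr ltn_mul2l f_gt0 /=.
  by case/andP: lq => _ lq; lia.
by apply: leq_trans E; rewrite -addnS leq_add2l.
Qed.

Local Notation invmod := (invmod q).
Local Notation P l := (ev z (pi_poly m n (invmod l))).
Local Notation below l i := (((q - l) * i %% q < l)%N : nat).

Lemma modq_cancel c i j : ~~ (q %| c)%N -> c * i == c * j %[mod q] -> i == j %[mod q].
Proof.
move=> qc; wlog ij : i j / (i <= j)%N => [H|].
  by case: (leqP i j) => [/H//|/ltnW/H Hji E]; rewrite eq_sym Hji // eq_sym.
rewrite eq_sym eqn_mod_dvd ?leq_mul2l ?ij ?orbT // -mulnBr Gauss_dvdr ?prime_coprime //.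
by rewrite -eqn_mod_dvd // eq_sym.
Qed.

(** As i runs over 1, ..., q - 1 the residues of (q - l) i run over the same
    numbers; l - 1 of them are below l, and the last one, for i = q - 1, is l. *)
Lemma sum_below l : (0 < l < q)%N -> (1 + \sum_(1 <= i < q.-1) below l i = l)%N.
Proof.
move=> lq; have /andP[l0 llq] := lq; have q0 := prime_gt0 q_prime.
have last : (((q - l) * q.-1) %% q = l)%N.
  have -> : ((q - l) * q.-1 = l + (q - l).-1 * q)%N by nia.
  by rewrite addnC modnMDl modn_small.
have tot : (\sum_(1 <= i < q) below l i = l.-1)%N.
  rewrite (reindex_range addn (s := fun i => ((q - l) * i %% q)%N)
    (fun j => ((j < l)%N : nat))).
  - rewrite (@big_cat_nat _ _ _ l) //=; last exact: ltnW.
    rewrite (eq_big_nat _ _ (F2 := fun=> 1%N)) => [|j /andP[_ ->] //].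
    rewrite [X in (_ + X)%N]big_nat [X in (_ + X)%N]big1 => [|j /andP[lj _]];
      last by rewrite ltnNge lj.
    by rewrite sum_nat_const_nat muln1 addn0 subn1.
  - move=> i /andP[i0 iq]; rewrite ltn_mod q0 andbT lt0n -/(dvdn q _) Euclid_dvdM // negb_or.
    by rewrite !gtnNdvd ?subn_gt0 //; lia.
  - move=> i j /andP[i0 iq] /andP[j0 jq] /eqP.
    move=> E; apply/eqP; rewrite -(modn_small iq) -(modn_small jq).
    apply: modq_cancel E; last by rewrite gtnNdvd ?subn_gt0 //; lia.
have q1 : (0 < q.-1)%N by lia.
move: tot; rewrite -{1}(prednK q0) big_nat_recr //= last ltnn addn0 => ->.
by rewrite add1n prednK.
Qed.

Lemma stickelberger_dvd k : (k <= q.-1)%N -> exists R,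
  \prod_(1 <= i < k) jacobi chi i =
  (\prod_(1 <= l < q) P l ^+ (\sum_(1 <= i < k) below l i)) * ev z R.
Proof.
elim: k => [_|k IH kq].
  exists 1; rewrite big_geq // ev1 mulr1 big1_seq // => l _.
  by rewrite big_geq // expr0.
have [->|k0] := posnP k.
  exists 1; rewrite big_geq // ev1 mulr1 big1_seq // => l _.
  by rewrite big_geq // expr0.
have [R ER] := IH (ltnW kq).
have [R' ER'] : exists R', ev z (jacobi_poly k) =
    (\prod_(1 <= l < q) P l ^+ below l k) * ev z R'.
  pose s := [seq l <- index_iota 1 q | ((q - l) * k %% q < l)%N].
  have [||R' ER'] := @dvd_pis q q_prime q_gt2 m n p p_def p_prime p_neq_q z s
    (jacobi_poly k) z_prim.
  - by rewrite filter_uniq ?iota_uniq.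
  - move=> l; rewrite mem_filter mem_index_iota => /andP[lk lq]; split=> //.
    by apply: jacobi_poly_root => //; lia.
  exists R'; rewrite ER' big_filter big_mkcond; congr (_ * _).
  by apply: eq_bigr => l _; case: ltnP.
exists (R * R'); rewrite big_nat_recr //= ER -ev_jacobi // ER' evM mulrACA; congr (_ * _).
rewrite -big_split; apply: eq_bigr => l _ /=.
by rewrite [in RHS]big_nat_recr // exprD.
Qed.

Lemma prod_P : \prod_(1 <= l < q) P l = p%:R.
Proof.
rewrite -(prod_pi q_prime q_gt2 p_def p_prime p_neq_q z_prim).
rewrite -[RHS](reindex_range _ (s := fun l => (invmod l %% q)%N)).
- by apply: eq_bigr => l _; rewrite (prim_expr_mod z_prim) !evE.
- move=> l lq; rewrite ltn_mod (prime_gt0 q_prime) andbT lt0n -/(dvdn q _).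
  apply/negP => ql; have := invmodP q_prime q_gt2 lq.
  by rewrite -modnMmr (eqP ql) muln0 mod0n modn_small ?prime_gt1.
- move=> l l' lq lq' E.
  apply/esym/(invmod_inj q_prime q_gt2 lq lq').
  by rewrite -modnMmr E modnMmr invmodP.
Qed.

(** Complex conjugation replaces 1 / l by - 1 / l = 1 / (q - l). *)
Lemma conj_P l : (0 < l < q)%N -> (P l)^* = P (q - l)%N.
Proof.
move=> lq; rewrite !evE rmorphB rmorphM !rmorph_int rmorphXn /=; congr (_ - _ * _).
have q0 := prime_gt0 q_prime; have /andP[l0 llq] := lq.
have lq' : (0 < q - l < q)%N by lia.
have zl : z ^+ invmod l != 0.
  rewrite expf_neq0 //; apply: expr1_neq0 (prim_expr_order z_prim); exact: prime_gt0.
apply: (mulfI zl).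
rewrite (conjC_root1 q0 (prim_expr_order z_prim)) -exprMn -exprS prednK //.
rewrite (prim_expr_order z_prim) expr1n -exprD; apply/esym/eqP.
rewrite -(prim_order_dvd z_prim).
have : (q %| l * (invmod l + invmod (q - l)))%N.
  rewrite mulnDr /dvdn -modnDml (invmodP q_prime q_gt2 lq).
  rewrite -(invmodP q_prime q_gt2 lq') modnDml.
  by rewrite -mulnDl subnK ?(ltnW llq) // modnMr.
by rewrite Gauss_dvdr // prime_coprime // gtnNdvd.
Qed.

Variable xi : algC.
Hypothesis xi_prim : p.-primitive_root xi.

(** Each side has absolute value p^(q / 2): for the product this is because the
    conjugate of the prime attached to l is the one attached to q - l, so that
    the exponents add up to q.  Thus the quotient satisfies the hypothesis of
    [ev_root_unity]. *)
Lemma stickelberger : exists k (e : int),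
  gauss xi chi 1 ^+ q = e%:~R * z ^+ k * \prod_(1 <= l < q) P l ^+ l.
Proof.
have [R ER] := stickelberger_dvd (leqnn q.-1).
pose Q := \prod_(1 <= l < q) P l ^+ l.
have G : gauss xi chi 1 ^+ q = Q * ev z R.
  rewrite (gauss_pow p_prime q_gt2 xi_prim chi_0 chi_M chi_X chi_N1 chi_nontrivial) ER.
  rewrite -prod_P mulrA; congr (_ * _); rewrite -big_split.
  by apply: eq_big_nat => l lq; rewrite /= -exprS -add1n sum_below.
have QQ : Q * Q^* = p%:R ^+ q.
  have -> : Q^* = \prod_(1 <= l < q) P l ^+ (q - l).
    rewrite /Q rmorph_prod big_nat_rev /=; apply: eq_big_nat => l lq.
    rewrite rmorphXn /= add1n subSS conj_P; last by lia.
    by congr (ev z (pi_poly m n (invmod _)) ^+ _); lia.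
  rewrite -big_split -prod_P -prodrXl; apply: eq_big_nat => l lq.
  by rewrite /= -exprD subnKC //; lia.
have p0 : (p%:R : algC) != 0 by rewrite pnatr_eq0 -lt0n prime_gt0.
have uu : ev z R * (ev z R)^* = 1.
  apply: (mulfI (expf_neq0 q p0)); rewrite mulr1 -{1}QQ mulrACA -rmorphM -G rmorphXn -exprMn.
  by rewrite (gauss_conj p_prime q_gt2 xi_prim chi_0 chi_M chi_X chi_N1 chi_nontrivial).
have [k [e [_ Eu]]] := ev_root_unity q_prime z_prim uu.
by exists k, e; rewrite G Eu mulrC.
Qed.

End Stickelberger.

(** * The criterion for q to be a q-th power modulo p *)

Section Criterion.

Variable q : nat.
Hypothesis q_prime : prime q.
Hypothesis q_gt2 : (2 < q)%N.
Variables (m n : int) (p : nat).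
Hypothesis p_def : p%:Z = \sum_(i < q) m ^+ i * n ^+ (q - 1 - i).
Hypothesis p_prime : prime p.
Hypothesis p_neq_q : p <> q.
Local Notation dlog := (dlog q m n (p := p)).
Local Notation Phi := (cyclo q).
Local Notation invmod := (invmod q).

(** The right-hand side of [stickelberger] modulo q^2, up to an integer factor, when
    a = - n / (m - n). *)
Definition unit_poly (a : int) (c : int) (k : nat) : {poly int} :=
  c%:P * 'X^k * \prod_(1 <= l < q) (1 + a%:P * ('X^(invmod l) - 1)) ^+ l.

Lemma logder_unit_poly a c k : logder q
  (0 + k%:R%:P + \sum_(1 <= l < q) ((invmod l)%:R *: (kummer_poly q a \Po 'X^(invmod l))) *+ l)
  (unit_poly a c k).
Proof.
apply: logderM; first by apply: logderM; [exact: logderC | exact: logderXn].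
apply: (big_rec2 (logder q)) => [|l K' F' _ KF]; first by rewrite -polyC1; exact: logderC.
apply: logderM => //; apply: logder_exp.
have -> : 1 + a%:P * ('X^(invmod l) - 1) = (1 + a%:P * ('X - 1)) \Po 'X^(invmod l).
  by rewrite -polyC1 comp_polyD comp_polyM comp_polyB comp_polyX !comp_polyC.
by apply: logder_Xj; exact: logder_kummer_poly.
Qed.

(** The l-th factor has derivative l^(- q) times that of 1 + a (X - 1), because of
    the substitution X -> X^(1 / l). *)
Lemma moment_unit_poly a (k : nat) :
  moment q.-1 (0 + k%:R%:P +
      \sum_(1 <= l < q) ((invmod l)%:R *: (kummer_poly q a \Po 'X^(invmod l))) *+ l)
  = (\sum_(1 <= l < q) (l * invmod l ^ q)%N%:R) * kummer q a.
Proof.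
rewrite add0r linearD linear_sum /= -[k%:R%:P]mulr1 -(expr0 'X) mul_polyC momentZ momentXn.
rewrite expr0n gtn_eqF ?mulr0 ?add0r; last by lia.
rewrite mulr_suml; apply: eq_bigr => l _.
rewrite linearMn /= momentZ moment_Xj moment_kummer_poly mulrA -exprS prednK ?prime_gt0 //.
by rewrite natrM natrX mulr_natl mulrnAl.
Qed.

Lemma sum_invmod : (q %| \sum_(1 <= l < q) (l * invmod l ^ q)%N%:R + 1)%Z.
Proof.
have -> : \sum_(1 <= l < q) (l * invmod l ^ q)%N%:R + 1 =
   \sum_(1 <= l < q) ((l * invmod l ^ q)%N%:R - 1) + q%:Z :> int.
  rewrite sumrB sumr_const_nat natrB ?prime_gt0 // natz; ring.
rewrite rpredD ?dvdzz // big_nat; apply: rpred_sum => l lq.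
rewrite natz -eqz_mod_dvd !modz_nat eqz_nat.
by rewrite -modnMmr fermat_little // modnMmr invmodP.
Qed.

Variable a : int.
Hypothesis aP : (q%:Z ^+ 2 %| (m - n) * a + n)%Z.

(** The polynomial [unit_poly] has a logarithmic derivative that is known in terms
    of [kummer] by [logder_unit_poly], and in terms of dlog q by
    [gauss_congr] and [logder_unit].  The latter is q dlog(q), the former is
    - kummer(a) modulo q^2. *)
Lemma residue_criterion : (q %| dlog q%:R)%N = (q%:Z ^+ 2 %| kummer q a)%Z.
Proof.
have q0 := prime_gt0 q_prime.
have [z z_prim] := C_prim_root_exists q0.
have [xi xi_prim] := C_prim_root_exists (prime_gt0 p_prime).
have zP := z_Fp_prim q_prime q_gt2 p_def p_prime p_neq_q.
have [k [e Ee]] := stickelberger q_prime q_gt2 p_def p_prime p_neq_q z_prim xi_prim.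
pose N := (\sum_(1 <= l < q) l)%N.
(* N is the exponent of m - n when it is taken out of each m - n zeta^k. *)
pose C := - e * (m - n) ^+ N.
have Alam := Aint_lam z_prim.
have Az := Aint_z z_prim.
have Alam1 : (1 - z) ^+ q.+1 \in Aint by rewrite rpredX.
have Api l : ev z (pi_poly m n (invmod l)) \in Aint by exact: (Aint_ev z_prim).
have Aa j : 1 + a%:~R * (z ^+ j - 1) \in Aint.
  by rewrite rpredD ?rpredM ?rpredB ?rpred1 ?rpredX ?Aint_int.
have q2_lam x y : cong (q%:R ^+ 2) x y -> cong ((1 - z) ^+ q.+1) x y.
  have [w Aw ->] := q_lam_pow q_prime q_gt2 z_prim.
  have -> : ((1 - z) ^+ q.-1 * w) ^+ 2 = (1 - z) ^+ q.+1 * ((1 - z) ^+ (q - 3) * w ^+ 2).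
    rewrite exprMn -exprM mulrA -exprD; congr (_ ^+ _ * _); lia.
  by apply: cong_dvd; rewrite rpredM ?rpredX.
(* m - n zeta^k = (m - n) - n (zeta^k - 1), and - n = (m - n) a modulo q^2. *)
have pi_cong l : cong (q%:R ^+ 2) (ev z (pi_poly m n (invmod l)))
    ((m - n)%:~R * (1 + a%:~R * (z ^+ invmod l - 1))).
  have /dvdzP[c Ec] := aP.
  exists (- c%:~R * (z ^+ invmod l - 1)).
    by rewrite rpredM ?rpredN ?rpredB ?rpredX ?rpred1 ?Aint_int.
  have En : n%:~R = c%:~R * q%:R ^+ 2 - (m - n)%:~R * a%:~R :> algC.
    have EnZ : n = c * q%:Z ^+ 2 - (m - n) * a by rewrite -Ec [_ + n]addrC addrK.
    by rewrite {1}EnZ rmorphB /= !rmorphM /= expr2.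
  rewrite !evE.
  have -> : (m%:~R : algC) = (m - n)%:~R + n%:~R by rewrite -rmorphD subrK.
  by rewrite En; ring.
have FG : cong ((1 - z) ^+ q.+1) (- gauss xi (chi z dlog) 1 ^+ q) (ev z (unit_poly a C k)).
  rewrite Ee; have -> : ev z (unit_poly a C k) = - (e%:~R * z ^+ k *
      \prod_(1 <= l < q) ((m - n)%:~R * (1 + a%:~R * (z ^+ invmod l - 1))) ^+ l).
    have -> : \prod_(1 <= l < q) ((m - n)%:~R * (1 + a%:~R * (z ^+ invmod l - 1))) ^+ l =
        (m - n)%:~R ^+ N * \prod_(1 <= l < q) (1 + a%:~R * (z ^+ invmod l - 1)) ^+ l :> algC.
      by rewrite /N expr_sum -big_split; apply: eq_bigr => l _; rewrite exprMn.
    have -> : ev z (unit_poly a C k) = C%:~R * z ^+ k *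
        \prod_(1 <= l < q) (1 + a%:~R * (z ^+ invmod l - 1)) ^+ l.
      rewrite /unit_poly evM evM evC evXn rmorph_prod; congr (_ * _).
      by apply: eq_bigr => l _; rewrite rmorphXn /= !evE.
    by rewrite /C rmorphM rmorphN rmorphXn /=; ring.
  apply: congN; apply: congM; first by rewrite rpredM ?rpredX ?Aint_int.
  apply: cong_prod => l.
  - by rewrite rpredX.
  - by rewrite rpredX // rpredM ?Aint_int.
  - by apply: congX; [exact: Alam1 | rewrite rpredM ?Aint_int | exact: q2_lam].
have Gnu := gauss_congr q_prime q_gt2 z_prim p_prime p_neq_q xi_prim
  (dlogM q_prime q_gt2 p_def p_prime p_neq_q).
have [y Ay Ey] : cong ((1 - z) ^+ q.+1) (ev z (unit_poly a C k))
    (1 + (dlog q%:R)%:R * (1 - z) ^+ q).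
  by apply: cong_trans Gnu; apply: cong_sym.
have [A [W EF]] := unit_expand q_prime q_gt2 z_prim (nu := (dlog q%:R)%:Z) Ay Ey.
have := logder_unit q_prime q_gt2 (logder_unit_poly a C k) EF.
rewrite moment_unit_poly.
have /dvdzP[h Eh] := dvdz_kummer q_prime q_gt2 a.
have /dvdzP[c Ec] := sum_invmod.
set S := \sum_(1 <= l < q) _ in Ec *.
have ES : S = c * q%:Z - 1 by rewrite -Ec addrK.
have qz : q%:Z != 0 by rewrite eqz_nat -lt0n.
have -> : S * kummer q a - q%:Z * (dlog q%:R)%:Z =
    q%:Z * (c * (h * q%:Z) - (h + (dlog q%:R)%:Z)).
  by rewrite Eh ES; ring.
rewrite expr2 dvdz_mul2l // => qh.
have -> : (q%:Z * q%:Z %| kummer q a)%Z = (q %| h)%Z by rewrite Eh mulrC dvdz_mul2l.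
have qs : (q %| h + (dlog q%:R)%:Z)%Z.
  have -> : h + (dlog q%:R)%:Z =
      c * h * q%:Z - (c * (h * q%:Z) - (h + (dlog q%:R)%:Z)) by ring.
  by rewrite rpredB // dvdz_mull.
rewrite -[LHS]/(q %| (dlog q%:R)%:Z)%Z.
by apply/idP/idP => qx; have := rpredB qs qx; rewrite ?addrK // addrC addKr.
Qed.

End Criterion.

(** * Reduction modulo the square of q and the main theorem *)

Section Reduction.

Variable q : nat.
Hypothesis q_prime : prime q.
Hypothesis q_gt2 : (2 < q)%N.

Lemma q2_gt1 : (1 < q ^ 2)%N.
Proof. by rewrite (ltn_exp2l 0 2) // prime_gt1. Qed.

Lemma Zq2_int_eq (x y : int) :
  (x%:~R == y%:~R :> 'Z_(q ^ 2)) = (q%:Z ^+ 2 %| x - y)%Z.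
Proof.
rewrite -subr_eq0 -rmorphB /=; move: (x - y) => {x y} x.
rewrite {1}[x]intEsign rmorphM rmorph_sign mulrI_eq0; last exact: lreg_sign.
rewrite /= -pmulrn -val_eqE /= val_Zp_nat ?q2_gt1 //.
Qed.

Lemma unit_Zq2 (d : int) : ~~ (q %| d)%Z -> (d%:~R : 'Z_(q ^ 2)) \is a GRing.unit.
Proof.
rewrite /dvdz /= => qd; rewrite [d]intEsign rmorphM rmorph_sign.
by rewrite unitrMl ?unitrX ?unitrN1 //= -pmulrn unitZpE ?q2_gt1 // coprimeXl // prime_coprime.
Qed.

Lemma redq2_add_q2 (c : int) (y : rat) : Zloc q y ->
  redq2 q (c%:~R + (q ^ 2)%:R * y) = c%:~R.
Proof.
move=> [s [t [qt ->]]].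
have t0 : t%:~R != 0 :> rat.
  by rewrite intr_eq0; apply: contraNneq qt => ->; rewrite dvdz0.
have -> : c%:~R + (q ^ 2)%:R * (s%:~R / t%:~R) = (c * t + (q ^ 2)%N%:Z * s)%:~R / t%:~R :> rat.
  by rewrite rmorphD !rmorphM /= -pmulrn; field.
rewrite redq2_frac //; apply: (mulIr (unit_Zq2 qt)); rewrite divrK ?unit_Zq2 //.
rewrite -rmorphM; apply/eqP; rewrite Zq2_int_eq addrAC subrr add0r.
by rewrite dvdz_mulr // -natz natrX natz.
Qed.

Lemma q2Zloc_int (c : int) : q2Zloc q c%:~R <-> (q%:Z ^+ 2 %| c)%Z.
Proof.
split=> [[y [s [t [qt Ey]]] E] | /dvdzP[d ->]].
  have t0 : t%:~R != 0 :> rat.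
    by rewrite intr_eq0; apply: contraNneq qt => ->; rewrite dvdz0.
  have E1 : c * t = q%:Z ^+ 2 * s.
    by apply: (@intr_inj rat); rewrite !rmorphM /= E Ey natrX expr2 -[LHS]mulrA divfK.
  have : (q%:Z ^+ 2 %| c * t)%Z by rewrite E1 dvdz_mulr.
  rewrite Gauss_dvdzl // coprimezXl // /coprimez /= -[_ == _]/(coprime q `|t|).
  by rewrite prime_coprime.
exists d%:~R; first exact: Zloc_int.
by rewrite !rmorphM /= mulrC.
Qed.

Lemma q2ZlocD x y : q2Zloc q x -> q2Zloc q y -> q2Zloc q (x + y).
Proof.
move=> [a Za ->] [b Zb ->]; exists (a + b); first exact: ZlocD.
by rewrite mulrDr.
Qed.

Lemma q2ZlocN x : q2Zloc q x -> q2Zloc q (- x).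
Proof.
move=> [a Za ->]; exists (-1 * a); last by rewrite mulN1r mulrN.
by apply: ZlocM => //; exact: (Zloc_int q_prime (-1)).
Qed.

Lemma ZlocX x k : Zloc q x -> Zloc q (x ^+ k).
Proof.
move=> Zx; elim: k => [|k IH]; first exact: (Zloc_int q_prime 1).
by rewrite exprS; apply: ZlocM.
Qed.

Lemma fq_congr (x y : rat) : Zloc q x -> Zloc q y -> q2Zloc q (x - y) ->
  q2Zloc q ((fq q).[x] - (fq q).[y]).
Proof.
move=> Zx Zy [d Zd Ed]; rewrite !horner_coef -sumrB.
exists (\sum_(i < size (fq q)) (fq q)`_i * (d * \sum_(j < i) x ^+ (i.-1 - j) * y ^+ j)).
  apply: Zloc_sum => // i _; apply: ZlocM => //; first exact: fq_Zloc.
  apply: ZlocM => //; apply: Zloc_sum => // j _.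
  by apply: ZlocM => //; exact: ZlocX.
rewrite mulr_sumr; apply: eq_bigr => i _.
by rewrite -mulrBr subrXX Ed; ring.
Qed.

Variables (m n : int) (p : nat).
Hypothesis p_def : p%:Z = \sum_(i < q) m ^+ i * n ^+ (q - 1 - i).
Hypothesis p_prime : prime p.
Hypothesis p_neq_q : p <> q.
Local Notation dlog := (dlog q m n (p := p)).

Lemma q_ndvd_mn : ~~ (q %| m - n)%Z.
Proof.
apply/negP; rewrite (dvdz_pcharf (pchar_Fp q_prime)) rmorphB subr_eq0 => /eqP mn.
have : (q %| p%:Z)%Z.
  rewrite (dvdz_pcharf (pchar_Fp q_prime)) p_def rmorph_sum /=.
  rewrite (eq_bigr (fun=> n%:~R ^+ (q - 1))) => [|i _].
    by rewrite sumr_const card_ord -mulr_natl pchar_Fp_0 // mul0r.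
  by rewrite rmorphM !rmorphXn /= mn -exprD; congr (_ ^+ _); have := ltn_ord i; lia.
by rewrite -[(_ %| _)%Z]/(q %| p)%N dvdn_prime2 // => /eqP qp; apply: p_neq_q.
Qed.

Lemma exists_inv_q2 : exists a : int, (q%:Z ^+ 2 %| (m - n) * a + n)%Z.
Proof.
have co : coprimez (m - n) (q%:Z ^+ 2).
  rewrite coprimez_sym coprimezXl // /coprimez /= -[_ == _]/(coprime q `|m - n|%N).
  by rewrite prime_coprime // q_ndvd_mn.
have [u [v uv]] := Bezoutz (m - n) (q%:Z ^+ 2).
exists (- n * u); apply/dvdzP; exists (n * v).
have uv1 : u * (m - n) + v * q%:Z ^+ 2 = 1 by rewrite uv; apply/eqP.
have -> : (m - n) * (- n * u) + n = n * (1 - u * (m - n)) by ring.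
rewrite -uv1; ring.
Qed.

(** An element of the cyclic group of units of F_p is a q-th power if and only if
    its (p - 1) / q-th power is 1. *)
Lemma residue_dlog : power_residue_symbol q q p = 1 <-> (q %| dlog q%:R)%N.
Proof.
have q0 := prime_gt0 q_prime.
have q_nz := prime_Fp_neq0 p_prime q_prime p_neq_q.
have fq := f_mul_q q_prime q_gt2 p_def p_prime p_neq_q.
have wP := w_prim q_prime q_gt2 p_def p_prime p_neq_q.
have [Eind indq] := dlogP q_prime q_gt2 p_def p_prime p_neq_q q_nz.
have -> : (q %| dlog q%:R)%N = ((q%:R : 'F_p) ^+ (p.-1 %/ q) == 1).
  by rewrite Eind (prim_order_dvd wP).
rewrite /power_residue_symbol; split.
  case: ifP => // /asboolP[b Eb] _.
  have Eb' : (q%:R : 'F_p) = b%:~R ^+ q.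
    apply/eqP; rewrite pmulrn -rmorphXn -subr_eq0 -rmorphB -(dvdz_pcharf (pchar_Fp p_prime)).
    by rewrite -eqz_mod_dvd; apply/eqP.
  rewrite Eb' -exprM mulnC fq Fp_fermat //.
  by apply: contraNneq q_nz => b0; rewrite Eb' b0 expr0n gtn_eqF.
move=> /eqP qf; case: ifP => // /asboolP; case.
have [x x_prim] := Fp_generator p_prime.
have [e Ee] := prim_rootP x_prim (Fp_fermat p_prime q_nz).
have /dvdnP[c Ec] : (q %| e)%N.
  have f0 := f_gt0 q_prime q_gt2 p_def p_prime p_neq_q.
  rewrite -(dvdn_pmul2r f0) mulnC fq (prim_order_dvd x_prim) exprM -Ee.
  exact/eqP.
exists (x ^+ c : 'F_p)%:Z; apply/eqP.
rewrite eqz_mod_dvd (dvdz_pcharf (pchar_Fp p_prime)) rmorphB rmorphXn /= -!pmulrn natr_Zp.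
by rewrite subr_eq0 -exprM -Ec Ee.
Qed.

End Reduction.

Theorem theorem1p4 (q : nat) (m n : int) (p : nat)
    (q_ge3 : (3 <= q)%N) (q_prime : prime q)
    (p_def : p%:Z = \sum_(i < q) m ^+ i * n ^+ (q - 1 - i))
    (p_prime : prime p) (p_neq_q : p <> q) :
  [<-> power_residue_symbol q q p = 1;
       q2Zloc q (fq q).[(- n)%:~R / (m - n)%:~R];
       redq2 q ((- n)%:~R / (m - n)%:~R) \in Sq q].
Proof.
have mn := q_ndvd_mn q_prime q_ge3 p_def p_prime p_neq_q.
have [a Ha] := exists_inv_q2 q_prime q_ge3 p_def p_prime p_neq_q.
have mn0 : (m - n)%:~R != 0 :> rat.
  by rewrite intr_eq0; apply: contraNneq mn => ->; rewrite dvdz0.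
have c1 : power_residue_symbol q q p = 1 <-> (q%:Z ^+ 2 %| kummer q a)%Z.
  by rewrite -(residue_criterion q_prime q_ge3 p_def p_prime p_neq_q Ha); exact: residue_dlog.
set x := _ / _.
have Zx : Zloc q x by exists (- n), (m - n).
have Za := Zloc_int q_prime a.
have xa : q2Zloc q (x - a%:~R).
  have /dvdzP[c Ec] := Ha.
  exists (- (c%:~R / (m - n)%:~R)).
    by rewrite -mulNr -rmorphN; exists (- c), (m - n).
  rewrite /x; have -> : (- n)%:~R = (m - n)%:~R * a%:~R - c%:~R * (q ^ 2)%:R :> rat.
    have En : - n = (m - n) * a - c * q%:Z ^+ 2 by rewrite -Ec; ring.
    by rewrite {1}En rmorphB /= !rmorphM.
  by move: (m - n)%:~R mn0 => M M0; field.
have c2 : q2Zloc q (fq q).[x] <-> (q%:Z ^+ 2 %| kummer q a)%Z.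
  rewrite -q2Zloc_int //.
  have xg : q2Zloc q ((fq q).[x] - (kummer q a)%:~R).
    rewrite -[(fq q).[x]](subrK (fq q).[a%:~R]) -addrA; apply: q2ZlocD => //.
      exact: fq_congr.
    exact: fq_kummer.
  split=> H; last by rewrite -[(fq q).[x]](subrK (kummer q a)%:~R); apply: q2ZlocD.
  rewrite -[(kummer q a)%:~R](subKr (fq q).[x]); apply: q2ZlocD => //; exact: q2ZlocN.
have redx : redq2 q x = a%:~R.
  rewrite /x redq2_frac //; apply: (mulIr (unit_Zq2 q_prime mn)).
  rewrite divrK ?unit_Zq2 // -rmorphM; apply/eqP; rewrite Zq2_int_eq // -rpredN /=.
  by have -> : - (- n - a * (m - n)) = (m - n) * a + n by ring.
have redb (b : nat) : redq2 q (b%:R - (fq q).[b%:R]) = (b%:Z - kummer q b)%:~R.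
  have [y Zy Ey] := fq_kummer q_prime q_ge3 b%:Z.
  have -> : b%:R - (fq q).[b%:R] = (b%:Z - kummer q b)%:~R + (q ^ 2)%:R * (-1 * y) :> rat.
    have -> : (fq q).[b%:R] = (kummer q b)%:~R + (q ^ 2)%:R * y by rewrite -Ey subrKC.
    by rewrite rmorphB /=; ring.
  by apply: redq2_add_q2 => //; apply: ZlocM => //; exact: (Zloc_int q_prime (-1)).
have c3 : redq2 q x \in Sq q <-> (q%:Z ^+ 2 %| kummer q a)%Z.
  have q0 := prime_gt0 q_prime.
  have gs b d := kummer_shift q_prime b d.
  rewrite redx; split=> [/imsetP[b _] | qg].
    rewrite redb => /eqP; rewrite Zq2_int_eq // => ab.
    have /dvdzP[h Eh] := dvdz_kummer q_prime q_ge3 b.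
    have /dvdzP[c Ec] := ab.
    (* a = b - kummer(b) modulo q^2 forces a = b modulo q. *)
    pose d := c * q%:Z - h.
    have Ea : a = b%:Z + q%:Z * d.
      rewrite -[a](subrK (b%:Z - kummer q b)) Ec Eh /d; ring.
    have := gs b d; rewrite -Ea => gad.
    have -> : kummer q a = (kummer q a - (kummer q b + q%:Z * d)) + (a - (b%:Z - kummer q b)).
      by rewrite {3}Ea; ring.
    by rewrite rpredD.
  have ab : (0 <= (a %% q)%Z) by rewrite modz_ge0 // eqz_nat -lt0n.
  have bq : (`|(a %% q)%Z| < q)%N.
    by rewrite -ltz_nat gez0_abs // ltz_pmod.
  apply/imsetP; exists (Ordinal bq) => //=; rewrite redb; apply/eqP.
  rewrite Zq2_int_eq // gez0_abs //.
  set b := (a %% q)%Z; set d := (a %/ q)%Z.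
  have Ea : a = b + q%:Z * d by rewrite {1}(divz_eq a q) addrC mulrC.
  have := gs b d; rewrite -Ea => gad.
  have -> : a - (b - kummer q b) =
      kummer q a - (kummer q a - (kummer q b + q%:Z * d)) by rewrite {1}Ea; ring.
  by rewrite rpredB.
by tfae => [/c1/c2 | /c2/c3 | /c3/c1].
Qed.
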